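(* Let $G$ be a finite group, let $F$ be an algebraically closed field of characteristic $p>0$, and let $B$ be a block of $FG$ with defect group $D$ of order $p^d>1$ and exponent $p^e$. Then $$LL(ZB)\le\Bigl(\frac{d}{e}+1\Bigr)\Bigl(\frac{d}{2}+\frac{1}{p-1}\Bigr)(p^e-1).$$ In particular, $LL(ZB)\le d^2p^e$.
   Context: A block $B$ of $FG$ is an indecomposable two-sided ideal direct summand of the group algebra $FG$; $ZB$ is its center, a commutative finite-dimensional local $F$-algebra. Defect groups of $B$ are in the usual sense of modular representation theory. For a finite-dimensional $F$-algebra $A$ with Jacobson radical $J(A)$, the Loewy length $LL(A)$ is the smallest integer $n\ge 0$ with $J(A)^n=0$. The fractions are fractions of rational numbers (no rounding). *)

(* Defs.v *)
From HB Require Import structures.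
From mathcomp Require Import all_boot all_order all_algebra.
From mathcomp Require Import all_fingroup all_solvable mxrepresentation.
From mathcomp Require Import boolp classical_sets.
Set Implicit Arguments.
Unset Strict Implicit.
Unset Printing Implicit Defensive.
Import GRing.Theory.
Local Open Scope ring_scope.

(* Finite-dimensional algebras are encoded, as in mxalgebra, by row spaces    *)
(* of type 'A[F]_n; the identity of such an algebra A is the e such that      *)
(* mxring_id A e, which need not be the identity matrix.                      *)

Section LoewyLength.

Variables (F : fieldType) (n : nat).
Implicit Types (A I J M : 'A[F]_n) (x : 'M[F]_n).

Definition max_left_ideal A M : Prop :=
  [/\ (M < A)%MS, left_mx_ideal A M
    & forall I, left_mx_ideal A I -> (M <= I)%MS -> (I < A)%MS -> (I <= M)%MS].

(* J encodes the intersection of A with all the maximal left ideals of A.     *)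
Definition is_jacobson A J : Prop :=
  forall x, (x \in J)%MS <->
    (x \in A)%MS /\ forall M, max_left_ideal A M -> (x \in M)%MS.

(* Such a J exists, by is_jacobson_jacobson below; it is unique up to :=:.    *)
Definition jacobson A : 'A[F]_n := xget 0 [set J | is_jacobson A J].

Lemma is_jacobson_jacobson A : is_jacobson A (jacobson A).
Proof.
rewrite /jacobson; apply: xgetPex.
pose P (J : 'A[F]_n) := (J <= A)%MS /\ forall x, (x \in A)%MS ->
  (forall M, max_left_ideal A M -> (x \in M)%MS) -> (x \in J)%MS.
pose Q k := `[< exists2 J, P J & \rank J = k >].
have exQ : exists k, Q k.
  by exists (\rank A); apply/asboolP; exists A => //; split.
case: (ex_minnP exQ) => k /asboolP[J [sJA PJ] rJ] minJ.
exists J => x; split=> [Jx | [Ax Mx]]; last exact: PJ.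
split=> [|M maxM]; first exact: submx_trans Jx sJA.
suff sJJM : (J <= J :&: M)%MS.
  by apply: submx_trans Jx (submx_trans sJJM (capmxSr _ _)).
have leJ : (\rank J <= \rank (J :&: M)%MS)%N.
  rewrite rJ minJ //; apply/asboolP; exists (J :&: M)%MS => //; split.
    exact: submx_trans (capmxSl _ _) sJA.
  by move=> y Ay My; rewrite sub_capmx PJ //= My.
by rewrite -(geq_leqif (mxrank_leqif_sup (capmxSl J M))).
Qed.

(* J(A)^k, with the convention J(A)^0 = A.                                    *)
Definition jacobson_pow A k : 'A[F]_n :=
  iter k (fun I : 'A[F]_n => (jacobson A * I)%MS : 'A[F]_n) A.

Definition is_loewy_length A l : Prop :=
  jacobson_pow A l = 0 /\ forall k, jacobson_pow A k = 0 -> (l <= k)%N.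

(* The default 0 is never used when A is an algebra with identity, by         *)
(* loewy_lengthP below.                                                       *)
Definition loewy_length A : nat := xget 0%N [set l | is_loewy_length A l].

Lemma mem_mulmxr m (R : 'A[F]_(m, n)) x z :
  reflect (exists2 y, (y \in R)%MS & z = y *m x)
          (z \in R *m lin_mx (mulmxr x))%MS.
Proof.
apply: (iffP idP) => [/submxP[a def_z] | [y /submxP[a def_y] ->]].
  exists (vec_mx (a *m R)); first by rewrite vec_mxK submxMl.
  by apply: (can_inj mxvecK); rewrite def_z mulmxA mul_rV_lin.
by apply/submxP; exists a; rewrite mulmxA -def_y mul_vec_lin.
Qed.

Lemma nakayama A I : mxring A -> (I <= A)%MS -> left_mx_ideal A I ->
  (I <= jacobson A * I)%MS -> I = 0.
Proof.
case/andP=> sAA /mxring_idP[e [_ Ae idA Aid]] sIA sAI sIJI.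
apply/eqP/negPn/negP=> nzI.
pose Q k := `[< exists2 N : 'A[F]_n, (N < I)%MS /\ left_mx_ideal A N
                & \rank N = k >].
have exQ : exists k, Q k.
  exists (\rank (0 : 'A[F]_n)); apply/asboolP; exists 0 => //; split.
    by rewrite lt0mx.
  by rewrite /left_mx_ideal mulsmx0 sub0mx.
have boundQ k : Q k -> (k <= \rank I)%N.
  by case/asboolP=> N [/ltmxW/mxrankS ? _] <-.
case: (ex_maxnP exQ boundQ) => k /asboolP[N [ltNI sAN] rN] maxN.
suff sJIN : (jacobson A * I <= N)%MS.
  by case/andP: ltNI => _ /negP; apply; apply: submx_trans sIJI sJIN.
apply/mulsmx_subP=> j x Jj Ix.
have [Aj maxj] := (is_jacobson_jacobson A j).1 Jj.
have [Nx | nNx] := boolP (x \in N)%MS; first exact: (mulsmx_subP sAN).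
pose L : 'A[F]_n := (A :&: kermx (lin_mx (mulmxr x) *m cokermx N))%MS.
have memL a : (a \in L)%MS = (a \in A)%MS && (a *m x \in N)%MS.
  by rewrite sub_capmx sub_kermx mulmxA mul_vec_lin /= -submxE.
suff maxL : max_left_ideal A L by have := maxj L maxL; rewrite memL => /andP[].
have Ax := submx_trans Ix sIA.
split.
- rewrite /ltmx capmxSl /=; apply/negP=> /memmx_subP/(_ e Ae).
  by rewrite memL idA // (negPf nNx) andbF.
- apply/mulsmx_subP=> a l Aa; rewrite !memL => /andP[Al Nlx].
  by rewrite (mulsmx_subP sAA) // -mulmxA (mulsmx_subP sAN).
move=> K sAK sLK /andP[sKA nsAK]; apply/memmx_subP=> y Ky.
rewrite memL (memmx_subP sKA) //=; apply/negPn/negP=> nNyx.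
have Ayx : (y *m x \in I)%MS by rewrite (mulsmx_subP sAI) ?(memmx_subP sKA).
pose N' : 'A[F]_n := (N + K *m lin_mx (mulmxr x))%MS.
have sN'I : (N' <= I)%MS.
  rewrite addsmx_sub (ltmxW ltNI); apply/memmx_subP=> _ /mem_mulmxr[z Kz ->].
  by rewrite (mulsmx_subP sAI) ?(memmx_subP sKA).
have ltNN' : (N < N')%MS.
  rewrite /ltmx addsmxSl /=; apply/negP=> /memmx_subP/(_ (y *m x)) sN'N.
  case/negP: nNyx; apply: sN'N; apply: submx_trans (addsmxSr _ _).
  by apply/mem_mulmxr; exists y.
have sAN' : left_mx_ideal A N'.
  apply/mulsmx_subP=> a _ Aa /memmx_addsP[[u v] /= [Nu /mem_mulmxr[z Kz ->] ->]].
   rewrite mulmxDr linearD /=.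
  apply: addmx_sub_adds; first exact: (mulsmx_subP sAN).
  by apply/mem_mulmxr; exists (a *m z); rewrite ?mulmxA ?(mulsmx_subP sAK).
have N'x : (x \in N')%MS.
  apply: submx_trans Ix _; apply/negPn/negP=> nsIN'.
  have : (\rank N' <= k)%N.
    by apply/maxN/asboolP; exists N' => //; split; rewrite // /ltmx sN'I.
  by move: ltNN'; rewrite ltmxErank rN ltnNge => /andP[_ /negP].
case/memmx_addsP: N'x => [[u v] /= [Nu /mem_mulmxr[z Kz ->] def_x]].
have Kez : (e - z \in K)%MS.
  apply: (memmx_subP sLK); rewrite memL mulmxBl idA // {1}def_x addrK Nu andbT.
  by rewrite linearB addmx_sub ?eqmx_opp // (memmx_subP sKA).
have Ke : (e \in K)%MS by rewrite -(subrK z e) linearD addmx_sub.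
case/negP: nsAK; apply/memmx_subP=> a Aa.
by rewrite -(Aid a Aa) (mulsmx_subP sAK).
Qed.

Lemma jacobson_pow_ideal A k : mxring A ->
  (jacobson_pow A k <= A)%MS /\ left_mx_ideal A (jacobson_pow A k).
Proof.
case/andP=> sAA _; have sJA : (jacobson A <= A)%MS.
  by apply/memmx_subP=> x /is_jacobson_jacobson[].
have sAJ : left_mx_ideal A (jacobson A).
  apply/mulsmx_subP=> a x Aa /is_jacobson_jacobson[Ax Mx].
  apply/is_jacobson_jacobson; split=> [|M maxM].
    by rewrite (mulsmx_subP sAA).
  by have [_ sAM _] := maxM; rewrite (mulsmx_subP sAM) ?Mx.
elim: k => [|k [sIA _]] //=; split.
  by apply: submx_trans (mulsmxS sJA sIA) sAA.
by rewrite /left_mx_ideal mulsmxA mulsmxS.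
Qed.

Lemma loewy_lengthP A : mxring A -> is_loewy_length A (loewy_length A).
Proof.
move=> ringA; rewrite /loewy_length; apply: xgetPex.
suff exk : exists k, jacobson_pow A k == 0.
  case: (ex_minnP exk) => l /eqP Jl0 minl.
  by exists l; split=> // k /eqP; apply: minl.
pose Q r := `[< exists k, \rank (jacobson_pow A k) = r >].
have exQ : exists r, Q r by exists (\rank A); apply/asboolP; exists 0%N.
case: (ex_minnP exQ) => r /asboolP[k rk] minr; exists k.
have [sIA sAI] := jacobson_pow_ideal k ringA.
apply/eqP/(nakayama ringA sIA sAI).
have sJI : (jacobson_pow A k.+1 <= jacobson_pow A k)%MS.
  apply/mulsmx_subP=> x y /is_jacobson_jacobson[Ax _] Iy.
  by rewrite (mulsmx_subP sAI).
rewrite -(geq_leqif (mxrank_leqif_sup sJI)) rk; apply: minr.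
by apply/asboolP; exists k.+1.
Qed.

Lemma mxring_center A : mxring A -> mxring 'Z(A)%MS.
Proof.
case/andP=> sAA /mxring_idP[e [nz_e Ae idA Aid]]; apply/andP; split.
  apply/mulsmx_subP=> x y /center_mxP[Ax cx] /center_mxP[Ay cy].
  apply/center_mxP; split=> [|z Az]; first by rewrite (mulsmx_subP sAA).
  by rewrite mulmxA cx // -!mulmxA cy.
apply/mxring_idP; exists e; split=> // [|x /center_mxP[] *|x /center_mxP[] *].
- by apply/center_mxP; split=> // x Ax; rewrite idA ?Aid.
- exact: idA.
exact: Aid.
Qed.

End LoewyLength.

Section Blocks.

Variables (F : fieldType) (gT : finGroupType) (G : {group gT}).
Implicit Types (B C I : 'A[F]_#|G|) (a e : 'M[F]_#|G|) (D H : {group gT}).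

Local Notation R_G := (group_ring F G).
Local Notation aG := (regular_repr F G).

Definition two_sided_ideal I : Prop := (I <= R_G)%MS /\ mx_ideal R_G I.

Definition is_block B : Prop :=
  [/\ two_sided_ideal B, B != 0,
      exists2 C, two_sided_ideal C & (B + C :=: R_G)%MS /\ mxdirect (B + C)
    & forall I C, two_sided_ideal I -> two_sided_ideal C ->
        (I + C :=: B)%MS -> mxdirect (I + C) -> I = 0 \/ C = 0].

Lemma mxring_block B : is_block B -> mxring B.
Proof.
case=> [[sBR /andP[sRB sBR']] nzB [C [sCR /andP[sRC sCR']] [defR dxBC]] _].
have BC0 x : (x \in B)%MS -> (x \in C)%MS -> x = 0.
  move=> Bx Cx; apply: memmx0.
  by rewrite -(mxdirect_addsP dxBC) sub_capmx Bx.
have R1 : (1%:M \in R_G)%MS by rewrite envelop_mx1.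
have [[b c] /= [Bb Cc def1]] : exists bc, [/\ (bc.1 \in B)%MS, (bc.2 \in C)%MS
    & 1%:M = bc.1 + bc.2] by apply/memmx_addsP; rewrite defR.
have idB y : (y \in B)%MS -> b *m y = y.
  move=> By; rewrite -[RHS]mul1mx def1 mulmxDl.
  rewrite [c *m y]BC0 ?addr0 //.
    by rewrite (mulsmx_subP sRB) ?(memmx_subP sCR).
  by rewrite (mulsmx_subP sCR') ?(memmx_subP sBR).
have Bid y : (y \in B)%MS -> y *m b = y.
  move=> By; rewrite -[RHS]mulmx1 def1 mulmxDr.
  rewrite [y *m c]BC0 ?addr0 //.
    by rewrite (mulsmx_subP sBR') ?(memmx_subP sCR).
  by rewrite (mulsmx_subP sRC) ?(memmx_subP sBR).
apply/andP; split.
  by apply/mulsmx_subP=> x y Bx By; rewrite (mulsmx_subP sRB) ?(memmx_subP sBR).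
apply/mxring_idP; exists b; split=> //; apply: contraNneq nzB => b0.
rewrite -submx0; apply/memmx_subP=> y By.
by rewrite -(idB y By) b0 mul0mx mem0mx.
Qed.

Definition fixed_by H a : Prop :=
  (a \in R_G)%MS /\ {in H, forall x, aG x^-1%g *m a *m aG x = a}.

(* Tr_H^G(a), the sum of the G-conjugates of a over the right cosets of H in  *)
(* G; it does not depend on the representatives when a is fixed by H.         *)
Definition rel_trace H a : 'M[F]_#|G| :=
  \sum_(X in rcosets H G) aG (repr X)^-1%g *m a *m aG (repr X).

(* The identity of B, i.e., the block idempotent, lies in Tr_H^G((FG)^H).     *)
Definition id_in_trace B H : Prop :=
  exists2 a, fixed_by H a & mxring_id B (rel_trace H a).

(* A defect group of B is a minimal subgroup D of G such that the block       *)
(* idempotent of B is a relative trace from D.                                *)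
Definition is_defect_group B D : Prop :=
  [/\ D \subset G, id_in_trace B D
    & forall H, H \subset D -> id_in_trace B H -> H :=: D].

End Blocks.

(* Main.v *)
(* Passman's argument. Filter Z(FG) by the orders of the defect groups of     *)
(* conjugacy classes: a block with defect group D lies in the span of the     *)
(* class sums whose defect groups are conjugate into D. Let a lie in level k  *)
(* of the filtration, let S <= D have order p ^ k, and put C = C_G(S), Z =    *)
(* Z(S). The Brauer homomorphism sends a to a class function b on C supported *)
(* on elements y for which Z is a Sylow p-subgroup of C_C(y). When such a b   *)
(* is invariant under multiplication by Z, it is constant on the p-sections   *)
(* of C, hence is annihilated by the nilpotent central elements. If Z is      *)
(* generated by x_1, x_2, ..., any product of more than N = sum (#[x_i] - 1)  *)
(* factors x_i - 1 vanishes, so by induction on j a product prod_(x in t) (x  *)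
(* - 1) * b * w_1 ... w_j with |t| + j > N is zero. Hence N + 1 nilpotent     *)
(* factors send level k to level k - 1, and N <= k (p ^ e - 1) / e. Summing   *)
(* over k gives the bound; for |D| = p the sum is p + 1, and one factor is    *)
(* saved because after p - 1 factors the class function is already constant   *)
(* on the p-sections of G.                                                    *)

Require Import Defs.
From HB Require Import structures.
From mathcomp Require Import all_boot all_order all_algebra.
From mathcomp Require Import all_fingroup all_solvable mxrepresentation.
From mathcomp Require Import zify ring.
Set Implicit Arguments.
Unset Strict Implicit.
Unset Printing Implicit Defensive.
Import GRing.Theory.
Local Open Scope group_scope.
Local Open Scope ring_scope.

(** Three facts carry the argument outlined above. A class function that depends only on the p'-part
    of its argument is killed by every nilpotent central element w ([reynolds]). Such a w acts
    nilpotently on permutation modules F[Q\H], so certain traces vanish; when Q is Sylow in the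
    centralizer of a p'-element g, these traces are, up to a nonzero scalar, the sums of the
    coefficients of translates of w over the section of g. If Z is a central p-subgroup of C, a
    Z-invariant class function supported on elements whose centralizers have Z as Sylow p-subgroup
    depends only on p'-parts. Invariance means annihilation by x - 1 for generators x of Z, so
    vanishing with one more factor x - 1 gives vanishing with one more nilpotent factor
    ([gaug_prod_mul0]). In characteristic p, a sum invariant under a p-group reduces to its fixed
    points ([sum_pgroup_fix]). This makes restriction to C_G(S) multiplicative, makes the levels
    ideals, and puts the block idempotent in the top level ([rel_trace_neq0]). Then [level_step]
    descends one level and [level_prod_eq0] adds up the costs. *)

Lemma nilpotent_trace0 (F : fieldType) n (A : 'M[F]_n) k :
  A ^+ k = 0 -> \tr A = 0.
Proof.
have [m] := ubnP n; elim: m n A k => // m IHm n A k /ltnSE-le_n_m Ak0.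
have [rA | ltrA] := eqVneq (\rank A) n.
  have uA : A \in unitmx by rewrite -row_full_unit /row_full rA.
  have uAk : A ^+ k \in unitmx.
    by elim: (k) => [|j IHj]; rewrite ?expr0 ?unitmx1 // exprS unitmx_mul uA.
  move: uAk; rewrite Ak0 -row_free_unit /row_free mxrank0 => /eqP n0.
  by rewrite /mxtrace big1 // => -[i lt_in]; exfalso; rewrite -n0 in lt_in.
have expE r (R : 'M_(r, n)) (C : 'M_(n, r)) j :
    (R *m C) ^+ j.+1 = R *m (C *m R) ^+ j *m C.
  elim: j => [|j IHj]; first by rewrite expr0 mulmx1 expr1.
  by rewrite exprS IHj exprS -[X in X = _]/(_ *m _) -[_ * _]/(_ *m _) !mulmxA.
rewrite -(mulmx_base A) mxtrace_mulC; apply: (IHm _ _ k.+1).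
  by rewrite (leq_trans _ le_n_m) // ltn_neqAle ltrA rank_leq_row.
by rewrite expE mulmx_base Ak0 mulmx0 mul0mx.
Qed.

(** A nontrivial orbit of P has size divisible by p, so its constant terms add up to 0. *)
Lemma sum_pgroup_fix (R : nzRingType) (p : nat) (aT : finGroupType)
    (P : {group aT}) (T : finType) (to : {action aT &-> T}) (S : {set T})
    (h : T -> R) :
    p \in [pchar R] -> p.-group P -> [acts P, on S | to] ->
    {in P & S, forall u x, h (to x u) = h x} ->
  \sum_(x in S) h x = \sum_(x in 'Fix_(S | to)(P)) h x.
Proof.
move=> chR pP actS inv_h.
rewrite (big_setID 'Fix_to(P)) /= [X in _ + X](_ : _ = 0) ?addr0 //.
have actS' : [acts P, on S :\: 'Fix_to(P) | to].
  apply/actsP=> u Pu x; rewrite !in_setD (acts_act actS) //.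
  by rewrite (acts_act (acts_fix_norm to (normG P))).
rewrite (set_partition_big _ (orbit_partition actS')) /=.
apply: big1 => _ /imsetP[x /setDP[Sx nfix_x] ->].
rewrite (eq_bigr (fun=> h x)) => [|_ /orbitP[u Pu <-]]; last exact: inv_h.
rewrite sumr_const -mulr_natr; suff /eqP-> : #|orbit to P x|%:R == 0 :> R.
  by rewrite mulr0.
rewrite -(dvdn_pcharf chR).
have /p_natP[[|k] oPx] : p.-nat #|orbit to P x|.
- by apply: pnat_dvd pP; rewrite card_orbit ?dvdn_indexg.
- case/negP: nfix_x; apply/afixP=> u Pu.
  have /eqP/cards1P[y def_y] := oPx.
  have orb_y z : z \in orbit to P x -> z = y by rewrite def_y => /set1P.
  by rewrite (orb_y _ (mem_orbit to x Pu)) [RHS]orb_y ?orbit_refl.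
by rewrite oPx expnS dvdn_mulr.
Qed.

(** * The group algebra *)

Section GroupAlgebra.

Variables (F : fieldType) (gT : finGroupType).

(* The algebra FH of a subgroup H is the set of functions supported on H,     *)
(* with the convolution product.                                              *)
Definition galg : predArgType := {ffun gT -> F}.
HB.instance Definition _ := GRing.Zmodule.on galg.
Definition gelem x : galg := [ffun y => (y == x)%:R].
Definition galg_mul (f g : galg) : galg :=
  [ffun x => \sum_y f y * g (y^-1 * x)%g].

Lemma galg_mulA : associative galg_mul.
Proof.
move=> f g h; apply/ffunP=> x; rewrite !ffunE.
under eq_bigr do rewrite ffunE mulr_sumr.
under [RHS]eq_bigr do rewrite ffunE mulr_suml.
rewrite [RHS]exchange_big /=; apply: eq_bigr => y _.
rewrite [RHS](reindex_inj (mulgI y)) /=; apply: eq_bigr => z _.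
by rewrite mulKg invMg !mulgA mulrA.
Qed.

Lemma galg_mul1l : left_id (gelem 1%g) galg_mul.
Proof.
move=> f; apply/ffunP=> x; rewrite ffunE (bigD1 1%g) //= ffunE eqxx mul1r.
rewrite invg1 mul1g big1 ?addr0 // => y /negPf ny.
by rewrite ffunE ny mul0r.
Qed.

Lemma galg_mul1r : right_id (gelem 1%g) galg_mul.
Proof.
move=> f; apply/ffunP=> x; rewrite ffunE (bigD1 x) //= ffunE mulVg eqxx mulr1.
rewrite big1 ?addr0 // => y /negPf ny.
by rewrite ffunE -eq_mulVg1 ny mulr0.
Qed.

Lemma galg_mulDl : left_distributive galg_mul +%R.
Proof.
move=> f g h; apply/ffunP=> x; rewrite !ffunE -big_split /=.
by apply: eq_bigr => y _; rewrite ffunE mulrDl.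
Qed.

Lemma galg_mulDr : right_distributive galg_mul +%R.
Proof.
move=> f g h; apply/ffunP=> x; rewrite !ffunE -big_split /=.
by apply: eq_bigr => y _; rewrite ffunE mulrDr.
Qed.

Lemma galg_one_neq0 : gelem 1%g != 0.
Proof.
apply/eqP=> /ffunP/(_ 1%g); rewrite !ffunE eqxx; apply/eqP/oner_neq0.
Qed.

HB.instance Definition _ := GRing.Zmodule_isNzRing.Build galg
  galg_mulA galg_mul1l galg_mul1r galg_mulDl galg_mulDr galg_one_neq0.

Implicit Types (f g : galg).

Lemma galgM f g x : (f * g) x = \sum_y f y * g (y^-1 * x)%g.
Proof. by rewrite ffunE. Qed.
Lemma galg0 x : (0 : galg) x = 0. Proof. by rewrite ffunE. Qed.
Lemma galgB f g x : (f - g) x = f x - g x. Proof. by rewrite !ffunE. Qed.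

End GroupAlgebra.

(** * Permutation modules and traces of central elements *)

Section FunMatrix.

Variables (F : fieldType) (T : finType) (R : {set T}).

(** The rows outside R vanish: this is phi acting on F[R], padded with zeros. Cosets can thus be
    indexed by all of [{set gT}], with no type of their own. *)
Definition fun_mx (phi : T -> T) : 'M[F]_#|T| :=
  \matrix_(i, j) ((enum_val i \in R) && (phi (enum_val i) == enum_val j))%:R.

Lemma fun_mxM phi psi : {homo phi : x / x \in R} ->
  fun_mx phi *m fun_mx psi = fun_mx (psi \o phi).
Proof.
move=> Rphi; apply/matrixP=> i k; rewrite !mxE /=.
rewrite (bigD1 (enum_rank (phi (enum_val i)))) //= !mxE enum_rankK eqxx andbT.
rewrite big1 ?addr0 => [|j]; last first.
  rewrite -(inj_eq enum_val_inj) enum_rankK eq_sym => /negPf ne_j.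
  by rewrite !mxE ne_j andbF mul0r.
have [Ri | _] := boolP (enum_val i \in R); last by rewrite mul0r.
by rewrite mul1r Rphi.
Qed.

Lemma eq_fun_mx phi psi : {in R, phi =1 psi} -> fun_mx phi = fun_mx psi.
Proof.
move=> eq_phi; apply/matrixP=> i j; rewrite !mxE.
by case: (boolP (_ \in R)) => // Ri; rewrite eq_phi.
Qed.

Lemma mxtrace_fun_mx phi :
  \tr (fun_mx phi) = #|[set x in R | phi x == x]|%:R.
Proof.
rewrite -sum1_card natr_sum big_mkcond /=.
rewrite (reindex _ (onW_bij _ (enum_val_bij T))) /=.
by apply: eq_bigr => i _; rewrite mxE inE; case: ifP.
Qed.

End FunMatrix.

Section Clfun.

Variables (F : fieldType) (gT : finGroupType).
Implicit Types (H : {group gT}) (f g : galg F gT) (x y : gT).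

Lemma gelem_mull x f y : (gelem F x * f) y = f (x^-1 * y)%g.
Proof.
rewrite galgM (bigD1 x) //= ffunE eqxx mul1r big1 ?addr0 // => z /negPf nz.
by rewrite ffunE nz mul0r.
Qed.

Lemma gelem_mulr x f y : (f * gelem F x) y = f (y * x^-1)%g.
Proof.
rewrite galgM (bigD1 (y * x^-1)%g) //= ffunE invMg invgK mulgKV eqxx mulr1.
rewrite big1 ?addr0 // => z nz; rewrite ffunE; case: eqP => [def_x | _].
  by case/eqP: nz; rewrite -def_x invMg invgK mulKVg.
by rewrite mulr0.
Qed.

Lemma gelemM x y : gelem F x * gelem F y = gelem F (x * y)%g.
Proof.
by apply/ffunP=> z; rewrite gelem_mull !ffunE -(inj_eq (mulgI x)) mulKVg.
Qed.

Lemma gelem1 : gelem F 1%g = 1 :> galg F gT. Proof. by []. Qed.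

Lemma gelemX x n : gelem F x ^+ n = gelem F (x ^+ n)%g.
Proof. by elim: n => [|n IHn] //; rewrite exprS IHn gelemM expgS. Qed.

Definition supported (A : {set gT}) f := forall x, x \notin A -> f x = 0.

Lemma supportedM H f g : supported H f -> supported H g -> supported H (f * g).
Proof.
move=> Hf Hg x nHx; rewrite galgM big1 // => y _.
have [Hy | nHy] := boolP (y \in H); last by rewrite Hf ?mul0r.
by rewrite Hg ?mulr0 // groupMl ?groupV.
Qed.

Lemma supported_gelem (A : {set gT}) x : x \in A -> supported A (gelem F x).
Proof.
by move=> Ax y nAy; rewrite ffunE; case: eqP nAy => // ->; rewrite Ax.
Qed.

(* The elements of the centre Z(FH). *)
Definition clfun H f :=
  supported H f /\ forall x h, h \in H -> f (x ^ h)%g = f x.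

Lemma clfun_comm H f g : clfun H f -> supported H g -> f * g = g * f.
Proof.
move=> [Hf f_cl] Hg; apply/ffunP=> x; rewrite !galgM.
rewrite (reindex_inj (inj_comp (mulgI x) invg_inj)) /=.
apply: eq_bigr => z _; have [Hz | nHz] := boolP (z \in H); last first.
  by rewrite invMg invgK mulgKV Hg // mul0r mulr0.
rewrite invMg invgK mulgKV mulrC; congr (_ * _).
by rewrite -(f_cl _ z Hz) conjgE mulgKV.
Qed.

Lemma clfunM H f g : clfun H f -> clfun H g -> clfun H (f * g).
Proof.
move=> [Hf f_cl] [Hg g_cl]; split=> [|x h Hh]; first exact: supportedM.
rewrite !galgM (reindex_inj (conjg_inj h)) /=; apply: eq_bigr => y _.
by rewrite f_cl // -conjVg -conjMg g_cl.
Qed.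

Lemma clfun1 H : clfun H 1.
Proof.
split=> [|x h Hh]; first by apply: supported_gelem; apply: group1.
by rewrite -gelem1 !ffunE conjg_eq1.
Qed.

Lemma clfun_prod H (ws : seq (galg F gT)) :
  {in ws, forall w, clfun H w} -> clfun H (\prod_(w <- ws) w).
Proof.
move=> wsH; rewrite big_seq; apply: (big_ind (clfun H)); first exact: clfun1.
  exact: clfunM.
by move=> w /wsH.
Qed.

Section Trace.

Variables (H Q : {group gT}).

Definition coset_mx f : 'M[F]_#|{set gT}| :=
  \sum_v f v *: fun_mx F (rcosets Q H) (fun X => X :* v)%g.

Lemma rcosets_mulr v : v \in H ->
  {homo (fun X => X :* v)%g : X / X \in rcosets Q H}.
Proof.
move=> Hv _ /rcosetsP[c Hc ->]; apply/rcosetsP; exists (c * v)%g.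
  by rewrite groupM.
by rewrite rcosetM.
Qed.

Lemma coset_mxM f g : supported H f ->
  coset_mx (f * g) = coset_mx f *m coset_mx g.
Proof.
move=> Hf; rewrite /coset_mx mulmx_suml.
under eq_bigr do rewrite galgM scaler_suml.
rewrite exchange_big /=; apply: eq_bigr => y _.
have [Hy | nHy] := boolP (y \in H); last first.
  by rewrite Hf // scale0r mul0mx big1 // => x _; rewrite mul0r scale0r.
rewrite mulmx_sumr (reindex_inj (mulgI y)); apply: eq_bigr => z _ /=.
rewrite mulKg -scalemxAl -scalemxAr fun_mxM; last exact: rcosets_mulr.
by rewrite scalerA; congr (_ *: _); apply: eq_fun_mx => X _ /=; rewrite rcosetM.
Qed.

Lemma coset_mxX f n : supported H f ->
  coset_mx (f ^+ n.+1) = coset_mx f ^+ n.+1.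
Proof.
move=> Hf; elim: n => [|n IHn]; first by rewrite !expr1.
by rewrite exprS coset_mxM // IHn [RHS]exprS.
Qed.

Lemma coset_mx0 : coset_mx 0 = 0.
Proof. by rewrite /coset_mx big1 // => v _; rewrite galg0 scale0r. Qed.

(* This is the trace of v |-> g * v * w * h on the permutation module F[Q\H]. *)
Lemma trace_rcosets (g h : gT) w n :
    g \in 'C(Q) -> g \in H -> h \in H -> clfun H w -> w ^+ n = 0 ->
  \sum_v (w * gelem F h) v
     * #|[set X in rcosets Q H | g *: X :* v == X]%g|%:R = 0.
Proof.
move=> cQg Hg Hh clw wn0; have [Hw _] := clw.
have sg : {homo (fun X => g *: X)%g : X / X \in rcosets Q H}.
  move=> _ /rcosetsP[c Hc ->]; apply/rcosetsP; exists (g * c)%g.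
    by rewrite groupM.
  by rewrite rcosetM (@norm_rlcoset _ Q g) ?(subsetP (cent_sub _)) // !mulgA.
pose L := fun_mx F (rcosets Q H) (fun X => g *: X)%g.
have cL f : supported H f -> L *m coset_mx f = coset_mx f *m L.
  move=> Hf; rewrite /coset_mx mulmx_sumr mulmx_suml; apply: eq_bigr => v _.
  have [Hv | nHv] := boolP (v \in H); last first.
    by rewrite Hf // !scale0r mul0mx mulmx0.
  rewrite -scalemxAl -scalemxAr !fun_mxM //; last exact: rcosets_mulr.
  congr (_ *: _); apply: eq_fun_mx => X _ /=.
  by rewrite mulgA.
have Hh' := supported_gelem Hh.
(* The nilpotent matrix of w commutes with both L and the matrix of h, so the whole product is
   nilpotent. *)
have : \tr (L *m coset_mx (w * gelem F h)) = 0.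
  rewrite (clfun_comm clw Hh') coset_mxM // mulmxA.
  apply: (@nilpotent_trace0 _ _ _ n.+1).
  have rho_w0 : coset_mx w ^+ n.+1 = 0.
    by rewrite -coset_mxX // exprS wn0 mulr0 coset_mx0.
  rewrite exprMn_comm ?rho_w0 ?mulr0 //.
  rewrite /GRing.comm -[X in X = _]/(_ *m _) -[X in _ = X]/(_ *m _).
  rewrite -mulmxA -coset_mxM // -(clfun_comm clw Hh') coset_mxM // mulmxA cL //.
  by rewrite -!mulmxA cL.
rewrite /coset_mx mulmx_sumr linear_sum /= => tr0; rewrite -[RHS]tr0.
apply: eq_bigr => v _.
by rewrite -scalemxAr linearZ /= fun_mxM // mxtrace_fun_mx.
Qed.

End Trace.

End Clfun.

(** * The Reynolds ideal *)

Section FixedCosets.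

Variables (gT : finGroupType) (p : nat) (H Q : {group gT}) (g : gT).
Hypotheses (p'g : p^'.-elt g) (sylQ : p.-Sylow('C_H[g]) Q).

Let fixc v := [set X in rcosets Q H | g^-1 *: X :* v == X]%g.

Lemma sylow_cent1 : Q \subset 'C[g].
Proof. by apply: subset_trans (pHall_sub sylQ) (subsetIr _ _). Qed.

Lemma fixed_rcosetE c v :
  (g^-1 *: (Q :* c) :* v == Q :* c)%g = (g^-1 * v ^ c^-1 \in Q)%g.
Proof.
have Cg : g^-1%g \in 'C(Q).
  by rewrite groupV -sub_cent1; apply: sylow_cent1.
rewrite mulgA -(@norm_rlcoset _ Q g^-1%g) ?(subsetP (cent_sub _)) //.
rewrite -!rcosetM (sameP eqP rcoset_eqP) mem_rcoset conjgE invgK !mulgA.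
by [].
Qed.

(** If Qc is fixed, then v is conjugate by c to gq with q in Q. Since q is a p-element commuting
    with the p'-element g, the p'-part of gq is g. *)
Lemma fixed_rcosets_constt v X : X \in fixc v ->
  exists2 c, c \in H & X = (Q :* c)%g /\ v.`_p^' = (g ^ c)%g.
Proof.
rewrite inE => /andP[/rcosetsP[c Hc ->]]; rewrite fixed_rcosetE => Qq.
exists c => //; split=> //; set q := (_ * _)%g in Qq.
have cgq : commute g q.
  by apply/commute_sym/cent1P; apply: (subsetP sylow_cent1).
have def_v : v = ((g * q) ^ c)%g by rewrite mulKVg conjgKV.
have pq : p.-elt q by apply: mem_p_elt Qq; apply: pHall_pgroup sylQ.
rewrite def_v consttJ consttM // (constt_p_elt p'g).
by rewrite (constt1P _) ?mulg1 // p_eltNK.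
Qed.

(** A fixed coset Qc has c in C_H(g), and on the cosets of Q in C_H(g) the map is right
    multiplication by the p-part of v. Fixed points of a p-group are then counted modulo p. *)
Lemma card_fixed_rcosets_constt v : v \in H -> v.`_p^' = g ->
  #|fixc v| = #|'C_H[g] : Q| %[mod p].
Proof.
move=> Hv def_g; have Cv : v.`_p \in 'C_H[g].
  rewrite inE groupX //=; apply/cent1P; rewrite -def_g.
  by apply: commuteX2.
have -> : #|'C_H[g] : Q| = #|rcosets Q 'C_H[g]| by [].
have sQ := pHall_sub sylQ.
have pv : p.-group <[v.`_p]> by apply: p_elt_constt.
have actv : [acts <[v.`_p]>, on rcosets Q 'C_H[g] | 'Rs].
  by apply: subset_trans (actsRs_rcosets _ _); rewrite cycle_subG.
rewrite [RHS](pgroup_fix_mod pv actv); congr (#|pred_of_set _| %% _)%N.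
have fixE c : c \in 'C_H[g] -> (g^-1 * v ^ c^-1)%g = ((v.`_p) ^ c^-1)%g.
  case/setIP=> _ Cc; have gc : (g ^ c^-1 = g)%g.
    by apply/conjg_fixP/commgP/cent1P; rewrite cent1C groupV.
  rewrite -{1}(consttC p v) def_g.
  have /cent1P-> : v.`_p \in 'C[g] by case/setIP: Cv.
  by rewrite conjMg gc mulKg.
apply/setP=> X; apply/idP/setIP=> [fX | [/rcosetsP[c Cc ->] fixX]].
  have [c Hc [defX gc]] := fixed_rcosets_constt fX.
  have Cc : c \in 'C_H[g].
    by rewrite inE Hc; apply/cent1P/commute_sym/commgP/conjg_fixP; rewrite -gc.
  split; first by rewrite defX; apply/rcosetsP; exists c.
  rewrite afix_cycle; apply/afix1P => /=; rewrite rcosetE defX.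
  move: fX; rewrite inE defX fixed_rcosetE fixE // => /andP[_ Qv].
  rewrite -rcosetM; apply/rcoset_eqP.
  by rewrite mem_rcoset; move: Qv; rewrite conjgE invgK mulgA.
have Hc := subsetP (subsetIl _ _) _ Cc.
rewrite inE fixed_rcosetE fixE //; apply/andP; split.
  by apply/rcosetsP; exists c.
move: fixX; rewrite afix_cycle => /afix1P /=; rewrite rcosetE -rcosetM.
by move/rcoset_eqP; rewrite mem_rcoset conjgE invgK mulgA.
Qed.

Lemma card_fixed_rcosetsJ v h : h \in H -> #|fixc (v ^ h)%g| = #|fixc v|.
Proof.
move=> Hh; rewrite -(card_imset (fixc v) (act_inj 'Rs h)) /=.
congr #|pred_of_set _|; apply/setP=> X; apply/idP/imsetP=> [|[Y]].
  rewrite inE => /andP[/rcosetsP[c Hc ->] fixX].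
  exists (Q :* (c * h^-1))%g; last by rewrite rcosetE -rcosetM mulgKV.
  rewrite inE fixed_rcosetE invMg invgK conjgM; apply/andP; split.
    by apply/rcosetsP; exists (c * h^-1)%g; rewrite // groupM ?groupV.
  by move: fixX; rewrite fixed_rcosetE.
rewrite inE => /andP[/rcosetsP[c Hc ->] fixY] ->; rewrite rcosetE -rcosetM.
rewrite inE fixed_rcosetE invMg conjgM conjgK.
apply/andP; split; last by move: fixY; rewrite fixed_rcosetE.
by apply/rcosetsP; exists (c * h)%g; rewrite // groupM.
Qed.

Lemma card_fixed_rcosets (F : fieldType) v : p \in [pchar F] -> v \in H ->
  #|fixc v|%:R = #|'C_H[g] : Q|%:R * (v.`_p^' \in g ^: H)%:R :> F.
Proof.
move=> chF Hv; case: imsetP => [[c Hc def_gc] | not_gc]; last first.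
  rewrite mulr0 (_ : fixc v = set0) ?cards0 //; apply/setP=> X.
  rewrite [RHS]inE; apply/negP=> /fixed_rcosets_constt[c Hc [_ gc]].
  by case: not_gc; exists c.
rewrite mulr1 -(card_fixed_rcosetsJ v (groupVr Hc)).
rewrite -(GRing.natr_mod_pchar chF #|fixc _|) card_fixed_rcosets_constt.
- exact: GRing.natr_mod_pchar.
- by rewrite groupJ ?groupV.
by rewrite consttJ def_gc conjgK.
Qed.

End FixedCosets.

Section Reynolds.

Variables (F : fieldType) (gT : finGroupType) (p : nat) (H : {group gT}).
Hypothesis chF : p \in [pchar F].
Implicit Types (f w : galg F gT).

(** The vanishing trace of [trace_rcosets], taken at g^-1, weights each v in the section of g by
    |C_H(g) : Q| and every other v by 0. This index is nonzero in F because Q is Sylow in C_H(g). *)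
Lemma sum_psection w n (g h : gT) :
    clfun H w -> w ^+ n = 0 -> h \in H -> g \in H -> p^'.-elt g ->
  \sum_(v in H | v.`_p^' \in g ^: H) (w * gelem F h) v = 0.
Proof.
move=> clw wn0 Hh Hg p'g; have [Hw _] := clw.
have pr_p := pcharf_prime chF.
have [Q sylQ] := Sylow_exists p 'C_H[g].
have /negPf nz_i : #|'C_H[g] : Q|%:R != 0 :> F.
  rewrite -(dvdn_pcharf chF) -prime.p'natE //.
  by case/and3P: sylQ.
have cQg : g^-1%g \in 'C(Q).
  by rewrite groupV -sub_cent1; apply: sylow_cent1 sylQ.
have := trace_rcosets cQg (groupVr Hg) Hh clw wn0.
rewrite (bigID (mem H)) /= [X in _ + X]big1 ?addr0 => [|v nHv]; last first.
  by rewrite (supportedM Hw (supported_gelem F Hh)) ?mul0r.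
under eq_bigr => v Hv do rewrite (card_fixed_rcosets p'g sylQ chF Hv) mulrCA.
rewrite -mulr_sumr => /eqP; rewrite mulf_eq0 nz_i => /eqP sum0.
rewrite -[RHS]sum0 big_mkcondr; apply: eq_bigr => v Hv.
by case: ifP => _; rewrite ?mulr1 ?mulr0.
Qed.

(* Such an f lies in the Reynolds ideal, the intersection of the centre with  *)
(* the socle.                                                                 *)
Lemma reynolds f w n : clfun H f -> {in H, forall x, f x = f x.`_p^'} ->
  clfun H w -> w ^+ n = 0 -> f * w = 0.
Proof.
move=> [Hf f_cl] fp' clw wn0; have [Hw _] := clw.
apply/ffunP=> x; have [Hx | nHx] := boolP (x \in H); last first.
  by rewrite galg0 (supportedM Hf Hw).
rewrite galgM galg0 (reindex_inj invg_inj) /=.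
rewrite (bigID (mem H)) /= [X in _ + X]big1 ?addr0 => [|v nHv]; last first.
  by rewrite Hf ?mul0r // groupV.
rewrite (partition_big (fun v => v.`_p^' ^: H) xpredT) //= big1 // => A _.
case: (pickP (fun v => (v \in H) && (v.`_p^' ^: H == A))) => [v0 | noA];
  last first.
  by apply: big_pred0.
case/andP=> Hv0 /eqP <-; set g := v0.`_p^'.
have Hg : g \in H by apply: groupX.
(* On the inverses of the elements of the section of g, f takes the single value f(g^-1). *)
transitivity (f g^-1%g *
    \sum_(v in H | v.`_p^' \in g ^: H) (w * gelem F x^-1%g) v).
  rewrite mulr_sumr; apply: eq_big => [v | v /andP[Hv /eqP gv]].
    by rewrite (sameP eqP class_eqP).
  rewrite gelem_mulr !invgK; congr (_ * _).
  rewrite fp' ?groupV // consttV.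
  have /class_eqP/imsetP[c Hc ->] := gv.
  by rewrite -conjVg f_cl.
by rewrite (sum_psection clw wn0) ?mulr0 ?groupV // p_elt_constt.
Qed.

End Reynolds.

(** * A central p-subgroup *)

Section Local.

Variables (F : fieldType) (gT : finGroupType) (p : nat).
Hypothesis chF : p \in [pchar F].
Implicit Types (a b v w : galg F gT) (x y : gT) (t xs : seq gT).
Implicit Types (C P Z : {group gT}).

(** P centralizes y, so it acts by conjugation on the factorizations of y as v(v^-1 y); only those
    with v in C(P) survive in characteristic p. *)
Lemma galgM_fix P a b y : p.-group P ->
    {in P, forall u x, a (x ^ u)%g = a x} ->
    {in P, forall u x, b (x ^ u)%g = b x} -> y \in 'C(P) ->
  (a * b) y = \sum_(v in 'C(P)) a v * b (v^-1 * y)%g.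
Proof.
move=> pP a_cl b_cl /centP Cy.
transitivity (\sum_(v in [set: gT]) a v * b (v^-1 * y)%g).
  by rewrite galgM; apply: eq_bigl => v; rewrite inE.
rewrite -afixJ (sum_pgroup_fix (to := 'J) chF pP) ?setTI //.
  by apply/actsP=> u _ x; rewrite !inE.
move=> u x Pu _ /=; rewrite a_cl //; congr (_ * _).
rewrite -[RHS](b_cl u Pu) conjMg conjVg; congr (b (_ * _)%g).
by apply/esym/conjg_fixP/commgP/Cy.
Qed.

(* All the classes in the support of b have Z as a defect group in C.         *)
Definition defect_supported C Z b :=
  clfun C b /\ forall y, b y != 0 -> p.-Sylow('C_C[y]) Z.

Lemma clfunB C a b : clfun C a -> clfun C b -> clfun C (a - b).
Proof.
move=> [Ca a_cl] [Cb b_cl]; split=> [x nCx | x h Ch].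
  by rewrite galgB Ca // Cb // subr0.
by rewrite !galgB a_cl // b_cl.
Qed.

Definition gaug x : galg F gT := gelem F x - 1.

Lemma pchar_galg : p \in [pchar galg F gT].
Proof.
have pr_p := pcharf_prime chF; rewrite inE pr_p /=; apply/eqP/ffunP=> x.
by rewrite ffunMnE -mulr_natr (pcharf0 chF) mulr0 galg0.
Qed.

Lemma gaugX x k : gaug x ^+ (p ^ k) = gaug (x ^+ (p ^ k)).
Proof.
elim: k => [|k IHk]; first by rewrite expn0 expr1 expg1.
have := pFrobenius_autB_comm pchar_galg (commr1 (gelem F (x ^+ (p ^ k))%g)).
rewrite !pFrobenius_autE -/(gaug _) -IHk -exprM expr1n gelemX -expgM.
by rewrite -expnSr.
Qed.

Lemma gaug_order0 x k : #[x] = (p ^ k)%N -> gaug x ^+ #[x] = 0.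
Proof. by move=> ox; rewrite ox gaugX -ox expg_order /gaug gelem1 subrr. Qed.

Lemma gaug_comm x y : commute x y -> GRing.comm (gaug x) (gaug y).
Proof.
move=> cxy; apply: commrD; last exact/commrN/commr1.
apply/commr_sym/commrD; last exact/commrN/commr1.
by rewrite /GRing.comm !gelemM cxy.
Qed.

Definition gaug_prod t := \prod_(x <- t) gaug x.

Lemma gaug_prod_count x t : {in t, forall y, commute x y} ->
  gaug_prod t = gaug x ^+ count_mem x t * gaug_prod [seq y <- t | y != x].
Proof.
rewrite /gaug_prod; elim: t => [|y t IHt] cxt; first by rewrite !big_nil mulr1.
rewrite big_cons IHt => [|z tz]; last by apply: cxt; rewrite inE tz orbT.
rewrite /=; case: eqVneq => [-> | _] /=; first by rewrite mulrA -exprS.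
rewrite big_cons !mulrA; congr (_ * _); apply/commr_sym/commr_sym/commrX.
by apply/gaug_comm/commute_sym/cxt; rewrite mem_head.
Qed.

Lemma size_count_undup (T : eqType) (t xs : seq T) : {subset t <= xs} ->
  size t = \sum_(x <- undup xs) count_mem x t.
Proof.
elim: t => [|y t IHt] sub_t; first by rewrite big1.
rewrite /= big_split /= -IHt => [|z tz]; last by rewrite sub_t ?inE ?tz ?orbT.
rewrite -[LHS]add1n; congr (_ + _)%N.
under eq_bigr do rewrite eq_sym.
rewrite -big_mkcond sum1_count count_uniq_mem ?undup_uniq // mem_undup.
by rewrite sub_t ?mem_head.
Qed.

(** By the pigeonhole principle some x occurs at least #[x] times in t, and (x - 1)^#[x] = 0 by the
    Frobenius map. *)
Lemma gaug_prod0 Z xs t : p.-group Z -> abelian Z -> {subset xs <= Z} ->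
    {subset t <= xs} -> (\sum_(x <- undup xs) (#[x] - 1) < size t)%N ->
  gaug_prod t = 0.
Proof.
move=> pZ cZZ sXZ sTX; rewrite (size_count_undup sTX) ltnNge => lt_t.
have [x /andP[Xx le_x]] : exists x, (x \in xs) && (#[x] <= count_mem x t)%N.
  apply/existsP; apply: contraNT lt_t => /existsPn noX.
  rewrite !big_seq; apply: leq_sum => x; rewrite mem_undup => Xx.
  by have := noX x; rewrite Xx /= -ltnNge -(ltn_predK (order_gt0 x)) subn1 ltnS.
have Zx := sXZ x Xx; rewrite (@gaug_prod_count x).
  have [k ox] := p_natP (mem_p_elt pZ Zx).
  by rewrite -(subnK le_x) exprD (gaug_order0 ox) mulr0 mul0r.
by move=> y ty; apply: (centsP cZZ) => //; apply/sXZ/sTX.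
Qed.

Section Central.

Variables (C Z : {group gT}).
Hypotheses (sZC : Z \subset C) (cZC : C \subset 'C(Z)) (pZ : p.-group Z).

Lemma clfun_gelem x : x \in Z -> clfun C (gelem F x).
Proof.
move=> Zx; split=> [|y h Ch]; first exact/supported_gelem/(subsetP sZC).
have xh : (x ^ h)%g = x by apply/conjg_fixP/commgP/commute_sym/(centsP cZC).
by rewrite !ffunE -{1}xh (inj_eq (conjg_inj h)).
Qed.

Lemma clfun_gaug x : x \in Z -> clfun C (gaug x).
Proof. by move=> Zx; apply: clfunB (clfun1 F C); apply: clfun_gelem. Qed.

Lemma clfun_gaug_prod t : {subset t <= Z} -> clfun C (gaug_prod t).
Proof.
move=> sTZ; rewrite /gaug_prod -(big_map gaug xpredT id); apply: clfun_prod.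
by move=> _ /mapP[x tx ->]; apply/clfun_gaug/sTZ.
Qed.

Lemma sub_cent1_central y : y \in C -> Z \subset 'C_C[y].
Proof. by move=> Cy; rewrite subsetI sZC sub_cent1 (subsetP cZC). Qed.

(** If P is Sylow in C_C(y) and y is in the support of the product, [galgM_fix] gives v in the
    support of b centralized by P. Hence |P| <= |Z|, while the central subgroup Z lies in C_C(y). *)
Lemma defect_supportedM b w :
  defect_supported C Z b -> clfun C w -> defect_supported C Z (b * w).
Proof.
move=> [clb Zb] clw; split=> [|y nzy]; first exact: clfunM.
have [[Cb b_cl] [Cw w_cl]] := (clb, clw).
have Cy : y \in C.
  by apply: contraNT nzy => nCy; rewrite (supportedM Cb Cw).
have [P sylP] := Sylow_exists p 'C_C[y].
have /subsetIP[sPC cPy] := pHall_sub sylP; have pP := pHall_pgroup sylP.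
have cyP : y \in 'C(P) by rewrite -sub_cent1.
have [v cPv nz_v] : exists2 v, v \in 'C(P) & b v != 0.
  apply/exists_inP; apply: contraNT nzy => /exists_inPn nzb.
  rewrite (galgM_fix pP) => [|u Pu x|u Pu x|//].
  - by rewrite big1 // => v /nzb/negPn/eqP->; rewrite mul0r.
  - by rewrite b_cl // (subsetP sPC).
  - by rewrite w_cl // (subsetP sPC).
have sylZ := Zb v nz_v.
rewrite pHallE sub_cent1_central // eqn_leq -(card_Hall sylP) /=.
rewrite (card_Hall sylP) -{1}(part_pnat_id pZ) dvdn_leq ?part_gt0 //=;
  last first.
  by rewrite partn_dvd ?cardG_gt0 // cardSg ?sub_cent1_central.
rewrite -(card_Hall sylP) (card_Hall sylZ) -(part_pnat_id pP).
rewrite dvdn_leq ?part_gt0 // partn_dvd ?cardG_gt0 // cardSg //.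
by rewrite subsetI sPC sub_cent1.
Qed.

Lemma mul_gaug_invariant (A : {set gT}) v : <<A>>%g = Z ->
  {in A, forall x, gaug x * v = 0} -> {in Z, forall x y, v (x * y)%g = v y}.
Proof.
move=> defZ Av.
have gv x : (gaug x * v == 0) = (gelem F x * v == v).
  by rewrite mulrBl mul1r subr_eq0.
have grS : group_set [set x | gelem F x * v == v].
  apply/group_setP; split=> [|x y]; first by rewrite inE gelem1 mul1r.
  by rewrite !inE -gelemM -mulrA => /eqP xv /eqP->; rewrite xv.
have sZS : Z \subset group grS.
  by rewrite -defZ gen_subG; apply/subsetP=> x Ax; rewrite inE -gv Av.
move=> x Zx y; have := subsetP sZS _ (groupVr Zx).
by rewrite inE => /eqP/ffunP/(_ y); rewrite gelem_mull invgK.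
Qed.

(** If the p-part of x is in Z, invariance applies. Otherwise both values are 0: that p-part
    centralizes x and its p'-part, and a central Sylow subgroup Z contains every p-element of the
    centralizer. *)
Lemma defect_supported_psection v x : defect_supported C Z v ->
    {in Z, forall z y, v (z * y)%g = v y} -> x \in C -> v x = v x.`_p^'.
Proof.
move=> [_ Zv] vZ Cx.
have xpZ y : x.`_p \in 'C[y] -> v y != 0 -> x.`_p \in Z.
  move=> cy /Zv sylZ; rewrite (mem_normal_Hall sylZ) ?p_elt_constt //.
    rewrite /normal (pHall_sub sylZ); apply: subset_trans (cents_norm cZC).
    exact: subsetIl.
  by rewrite inE groupX.
have [/vZ v_xp | nZx] := boolP (x.`_p \in Z).
  by rewrite -{1}(consttC p x) v_xp.
transitivity (0 : F); first last.
  apply/esym/eqP/(contraNT _ nZx)/xpZ.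
  by apply/cent1P/commute_sym/commuteX2.
apply/eqP/(contraNT _ nZx)/xpZ.
by apply/cent1P/commute_sym/commuteX.
Qed.

(** Induction on [ws], with t generalized: removing the last nilpotent factor w leaves a product v
    that is killed by each x - 1, since adding x to t preserves the total length. So v is
    Z-invariant, and v * w = 0 by [reynolds]. *)
Lemma gaug_prod_mul0 xs N (ws : seq (galg F gT)) b t :
    <<[set x in xs]>>%g = Z ->
    (forall s, {subset s <= xs} -> (N < size s)%N -> gaug_prod s = 0) ->
    defect_supported C Z b ->
    {in ws, forall w, clfun C w /\ exists n, w ^+ n = 0} ->
    {subset t <= xs} -> (N < size t + size ws)%N ->
  gaug_prod t * (b * \prod_(w <- ws) w) = 0.
Proof.
move=> defZ nilX Zb; have sXZ : {subset xs <= Z}.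
  by move=> x Xx; rewrite -defZ mem_gen ?inE.
elim/last_ind: ws t => [|ws w IHws] t wsC sTX.
  by rewrite addn0 => /nilX->; rewrite ?mul0r.
rewrite size_rcons addnS -addSn => lt_N.
have wsC' : {in ws, forall w, clfun C w /\ exists n, w ^+ n = 0}.
  by move=> w' ws_w'; apply: wsC; rewrite mem_rcons inE ws_w' orbT.
have [|clw [n wn0]] := wsC w; first by rewrite mem_rcons mem_head.
have clws : clfun C (\prod_(w <- ws) w) by apply: clfun_prod => w' /wsC'[].
have clt : clfun C (gaug_prod t) by apply: clfun_gaug_prod => x /sTX/sXZ.
rewrite -cats1 big_cat big_seq1 /= !mulrA.
set v := gaug_prod t * b * _.
have Zv : defect_supported C Z v.
  rewrite /v (clfun_comm clt) //; last by case: Zb => [[]].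
  by do 2!apply: defect_supportedM => //.
have vZ : {in Z, forall z y, v (z * y)%g = v y}.
  apply: mul_gaug_invariant defZ _ => x; rewrite inE => Xx.
  have := IHws (x :: t) wsC' _ lt_N.
  rewrite /v /gaug_prod big_cons -!mulrA; apply.
  by move=> y /[1!inE] /predU1P[-> | /sTX].
have [clv _] := Zv.
apply: (reynolds chF clv _ clw wn0) => x Cx.
exact: defect_supported_psection.
Qed.

End Central.

End Local.

(** * Generators of abelian p-groups of bounded exponent *)

Section AbelianGenerators.

Local Open Scope nat_scope.

(** The quotient (p^a - 1)/a grows with a; denominators are cleared. *)
Lemma leq_expn_pred p a e : 0 < p -> a <= e ->
  e * (p ^ a - 1) <= a * (p ^ e - 1).
Proof.
move=> p_gt0; elim: e => [|e IHe]; first by rewrite leqn0 => /eqP->.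
rewrite leq_eqVlt => /predU1P[-> // | /[!ltnS] le_ae].
have [-> | a_gt0] := posnP a; first by rewrite expn0 subnn muln0.
have pa_gt0 : 0 < p ^ a by rewrite expn_gt0 p_gt0.
have pe_gt0 : 0 < p ^ e by rewrite expn_gt0 p_gt0.
have [p1 | p_gt1] := leqP p 1.
  by have -> : p = 1 by [apply/eqP; rewrite eqn_leq p1]; rewrite !exp1n !muln0.
have le_pae : p ^ a <= p ^ e by rewrite leq_exp2l.
have := IHe le_ae; rewrite expnS; move: (p ^ a) (p ^ e) pa_gt0 pe_gt0 le_pae.
move=> m n m_gt0 n_gt0 le_mn IH.
rewrite (_ : p * n - 1 = (n - 1) + (p - 1) * n); last by nia.
rewrite mulnDr mulSn addnC; apply: leq_add => //.
by nia.
Qed.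

Lemma sum_prime_powers p e (ns : seq nat) : prime p ->
    {in ns, forall n, exists2 a, n = p ^ a & a <= e} ->
  e * (\sum_(n <- ns) (n - 1)) <= logn p (\prod_(n <- ns) n) * (p ^ e - 1).
Proof.
move=> pr_p; elim: ns => [|n ns IHns] ns_p; first by rewrite !big_nil muln0.
have {}IHns := IHns (fun m ms => ns_p m (mem_behead (s := n :: ns) ms)).
have [a def_n le_ae] := ns_p n (mem_head n ns).
have n_gt0 : 0 < n by rewrite def_n expn_gt0 prime_gt0.
have ns_gt0 : 0 < \prod_(m <- ns) m.
  rewrite big_seq; apply: (big_ind (leq 1)) => // [m1 m2|m ms].
    by rewrite muln_gt0 => ->.
  have [b -> _] := ns_p m (mem_behead (s := n :: ns) ms).
  by rewrite expn_gt0 prime_gt0.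
rewrite !big_cons lognM // mulnDr mulnDl leq_add // def_n pfactorK //.
by rewrite leq_expn_pred ?prime_gt0.
Qed.

(** Take generators of the cyclic factors, of orders p^a_i with a_i <= e and sum s, and apply
    [leq_expn_pred] to each. *)
Lemma abelian_generators (gT : finGroupType) (p s e : nat) (Z : {group gT}) :
    prime p -> abelian Z -> #|Z| = p ^ s -> exponent Z %| p ^ e ->
  exists2 xs : seq gT, <<[set x in xs]>>%g = Z
    & e * (\sum_(x <- undup xs) (#[x]%g - 1)) <= s * (p ^ e - 1).
Proof.
move=> pr_p cZZ oZ expZ; have [b defZ _] := abelian_structure cZZ.
have genZ : <<[set x in b]>>%g = Z.
  rewrite -(bigdprodWY defZ); apply/eqP; rewrite eqEsubset !gen_subG.
  apply/andP; split.
    apply/subsetP=> x; rewrite inE => bx; apply: mem_gen.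
    by rewrite bigcup_seq; apply/bigcupP; exists x => //; apply: cycle_id.
  rewrite bigcup_seq; apply/bigcupsP=> x bx.
  by rewrite cycle_subG mem_gen // inE.
exists b => //; apply: (@leq_trans (e * \sum_(x <- b) (#[x]%g - 1))).
  rewrite leq_mul2l; apply/orP; right.
  elim: (b) => //= x b' IHb; rewrite big_cons; case: ifP => _.
    exact: leq_trans IHb (leq_addl _ _).
  by rewrite big_cons leq_add2l.
have := @sum_prime_powers p e (map order b) pr_p.
rewrite !big_map (bigdprod_card defZ) oZ pfactorK //; apply.
move=> _ /mapP[x bx ->].
have Zx : x \in Z by rewrite -genZ mem_gen // inE.
have /(dvdn_pfactor _ _ pr_p)[a le_ae ox] : #[x]%g %| p ^ e.
  exact: dvdn_trans (dvdn_exponent Zx) expZ.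
by exists a.
Qed.

End AbelianGenerators.

(** * The Brauer homomorphism and defect groups of classes *)

Section Levels.

Variables (F : fieldType) (gT : finGroupType) (p : nat).
Variables (G D : {group gT}) (d e : nat).
Hypothesis chF : p \in [pchar F].
Hypotheses (sDG : D \subset G) (oD : #|D| = (p ^ d)%N).
Hypothesis (expD : exponent D = (p ^ e)%N).
Implicit Types (a b w : galg F gT) (x y : gT) (P S : {group gT}).

Let pr_p : prime p. Proof. exact: pcharf_prime chF. Qed.
Let pD : p.-group D. Proof. by rewrite /pgroup oD pnatX pnat_id. Qed.

(* The Brauer homomorphism at S is [brauer_map 'C_G(S)]. *)
Definition brauer_map (C : {set gT}) a : galg F gT :=
  [ffun x => if x \in C then a x else 0].

Lemma clfun_brauer_map S a : clfun G a -> S \subset G ->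
  clfun 'C_G(S) (brauer_map 'C_G(S) a).
Proof.
move=> [_ a_cl] sSG; split=> [x /negPf nCx | x h Ch].
  by rewrite ffunE nCx.
by rewrite !ffunE groupJr // a_cl //; case/setIP: Ch.
Qed.

Lemma brauer_mapM S a b : clfun G a -> clfun G b -> S \subset G -> p.-group S ->
  brauer_map 'C_G(S) (a * b) = brauer_map 'C_G(S) a * brauer_map 'C_G(S) b.
Proof.
move=> cla clb sSG pS; have [[Ga a_cl] [Gb b_cl]] := (cla, clb).
have [Ca _] := clfun_brauer_map cla sSG.
have [Cb _] := clfun_brauer_map clb sSG.
apply/ffunP=> x; rewrite ffunE; case: ifPn => [Cx | nCx]; last first.
  by rewrite (supportedM Ca Cb).
have [_ cSx] := setIP Cx.
rewrite (galgM_fix chF pS) => [|u Su y|u Su y|//]; first last.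
- by rewrite b_cl // (subsetP sSG).
- by rewrite a_cl // (subsetP sSG).
rewrite galgM big_mkcond /=; apply: eq_bigr => v _; rewrite !ffunE.
case: ifPn => [cSv | ncSv]; last by rewrite inE (negPf ncSv) andbF mul0r.
have [Gv | nGv] := boolP (v \in G); last by rewrite inE (negPf nGv) Ga ?mul0r.
have Cv : v \in 'C_G(S) by rewrite inE Gv.
by rewrite Cv groupM ?groupV.
Qed.

Lemma brauer_map1 S : brauer_map 'C_G(S) 1 = 1.
Proof.
apply/ffunP=> x; rewrite -gelem1 !ffunE; case: ifPn => //.
by case: eqP => // ->; rewrite group1.
Qed.

Definition znil w := clfun G w /\ exists n, w ^+ n = 0.

Lemma znil_brauer_map S w : znil w -> S \subset G -> p.-group S ->
  clfun 'C_G(S) (brauer_map 'C_G(S) w) /\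
  exists n, brauer_map 'C_G(S) w ^+ n = 0.
Proof.
move=> [clw [n wn0]] sSG pS; split; first exact: clfun_brauer_map.
exists n; suff [<- _] : brauer_map 'C_G(S) (w ^+ n) = brauer_map 'C_G(S) w ^+ n
    /\ clfun G (w ^+ n).
  by rewrite wn0; apply/ffunP=> x; rewrite !ffunE if_same.
elim: n {wn0} => [|n [IHn cln]].
  by rewrite brauer_map1; split=> //; apply: clfun1.
by rewrite !exprS brauer_mapM // IHn; split=> //; apply: clfunM.
Qed.

Lemma brauer_map_prod S (ws : seq (galg F gT)) :
    {in ws, forall w, clfun G w} -> S \subset G -> p.-group S ->
  brauer_map 'C_G(S) (\prod_(w <- ws) w)
    = \prod_(w <- map (brauer_map 'C_G(S)) ws) w.
Proof.
move=> wsG sSG pS; elim: ws wsG => [|w ws IHws] wsG.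
  by rewrite !big_nil brauer_map1.
have wsG' : {in ws, forall w, clfun G w}.
  by move=> w' ws_w'; apply: wsG; rewrite inE ws_w' orbT.
rewrite /= !big_cons brauer_mapM ?IHws //; last exact: clfun_prod.
by apply: wsG; rewrite mem_head.
Qed.

(* The class functions supported on the classes whose defect groups are       *)
(* conjugate to subgroups of D and have order less than p ^ k.                *)
Definition level k a := clfun G a /\ forall x, a x != 0 ->
  (#|'C_G[x]|`_p < p ^ k)%N /\
  exists P g, [/\ g \in G, p.-Sylow('C_G[x]) P & P :^ g \subset D].

(** A defect group of a class in the support of the product centralizes some v in the support of a,
    so it is conjugate into a defect group of v. *)
Lemma levelM k a w : level k a -> clfun G w -> level k (a * w).
Proof.
move=> [cla suppa] clw; split=> [|x nzx]; first exact: clfunM.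
have [[Ga a_cl] [Gw w_cl]] := (cla, clw).
have [P sylP] := Sylow_exists p 'C_G[x].
have /subsetIP[sPG cPx] := pHall_sub sylP; have pP := pHall_pgroup sylP.
have cxP : x \in 'C(P) by rewrite -sub_cent1.
have [v cPv nz_v] : exists2 v, v \in 'C(P) & a v != 0.
  apply/exists_inP; apply: contraNT nzx => /exists_inPn nza.
  rewrite (galgM_fix chF pP) => [|u Pu y|u Pu y|//].
  - by rewrite big1 // => v /nza/negPn/eqP->; rewrite mul0r.
  - by rewrite a_cl // (subsetP sPG).
  - by rewrite w_cl // (subsetP sPG).
have [lt_v [Q [g [Gg sylQ sQD]]]] := suppa v nz_v.
have sPv : P \subset 'C_G[v] by rewrite subsetI sPG sub_cent1.
have [h /setIP[Gh _] sPhQ] := Sylow_Jsub sylQ sPv pP.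
split.
  rewrite -(card_Hall sylP); apply: leq_ltn_trans lt_v.
  rewrite -(card_Hall sylQ) -(cardJg P h); exact: subset_leq_card.
exists P, (h * g)%g; split; rewrite ?groupM // conjsgM.
by apply: subset_trans sQD; rewrite conjSg.
Qed.

(** The order bound makes S Sylow in C_G(y). The centralizer of S in C_G(y) is normal in the
    normalizer of S there, so it meets S in a Sylow subgroup, and this intersection is Z(S). *)
Lemma level_brauer_map k a S :
    level k.+1 a -> S \subset D -> #|S| = (p ^ k)%N ->
  defect_supported p 'C_G(S) 'Z(S) (brauer_map 'C_G(S) a).
Proof.
move=> [cla suppa] sSD oS; have sSG := subset_trans sSD sDG.
split=> [|y]; first exact: clfun_brauer_map.
rewrite ffunE; case: ifPn => [/setIP[Gy cSy] nzy | _ /eqP//].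
have [lt_y _] := suppa y nzy.
have sSy : S \subset 'C_G[y] by rewrite subsetI sSG sub_cent1.
have sylS : p.-Sylow('C_G[y]) S.
  rewrite pHallE sSy eq_sym eqn_dvd oS p_part !dvdn_Pexp2l ?prime_gt1 //.
  move: lt_y; rewrite p_part ltn_exp2l ?prime_gt1 // ltnS => -> /=.
  by rewrite -(pfactorK k pr_p) -oS dvdn_leq_log ?cardSg.
have sylN : p.-Sylow('N_('C_G[y])(S)) S.
  by apply: pHall_subl sylS; rewrite ?subsetIl // subsetI sSy normG.
have nSN : S <| 'N_('C_G[y])(S).
  by rewrite /normal subsetIr subsetI sSy normG.
have -> : 'C_('C_G(S))[y] = 'C_('C_G[y])(S) by rewrite setIAC.
have defZ : 'Z(S) = S :&: 'C_('C_G[y])(S).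
  by rewrite /center setIA (setIidPl sSy).
by rewrite /= defZ; apply: setI_normal_Hall nSN sylN _; rewrite setIS ?cent_sub.
Qed.

(** Empty t serves the descent in [level_step]; a singleton t yields the D-invariance in
    [prime_level_prod_eq0]. *)
Lemma brauer_map_mul0 k a S : level k.+1 a -> S \subset D -> #|S| = (p ^ k)%N ->
  exists2 xs : seq gT, <<[set x in xs]>>%g = 'Z(S) &
    forall t (ws : seq (galg F gT)), {subset t <= xs} ->
      {in ws, forall w, znil w} ->
      (k * (p ^ e - 1) < e * (size t + size ws))%N ->
    gaug_prod F t * brauer_map 'C_G(S) (a * \prod_(w <- ws) w) = 0.
Proof.
move=> lev_a sSD oS; have sSG := subset_trans sSD sDG.
have pS := pgroupS sSD pD; have sZS := center_sub S.
have pZ : p.-group 'Z(S) := pgroupS sZS pS.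
have [s oZ] := p_natP pZ.
have le_sk : (s <= k)%N.
  by rewrite -(leq_exp2l _ _ (prime_gt1 pr_p)) -oZ -oS subset_leq_card.
have expZ : (exponent 'Z(S) %| p ^ e)%N.
  by rewrite -expD exponentS // (subset_trans sZS).
have [xs defZ le_xs] := abelian_generators pr_p (center_abelian S) oZ expZ.
exists xs => // t ws sTX wsG lt_k; have [cla _] := lev_a.
have wscl : {in ws, forall w, clfun G w} by move=> w /wsG[].
rewrite brauer_mapM ?brauer_map_prod //; last exact: clfun_prod.
have sZC : 'Z(S) \subset 'C_G(S) by rewrite setSI.
have cZC : 'C_G(S) \subset 'C('Z(S)).
  exact: subset_trans (subsetIr _ _) (centS sZS).
apply: (gaug_prod_mul0 chF sZC cZC pZ defZ) sTX _.
- move=> s' sX; apply: (gaug_prod0 chF pZ (center_abelian S)) sX.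
  by move=> x xs_x; rewrite -defZ mem_gen ?inE.
- exact: level_brauer_map lev_a sSD oS.
- by move=> _ /mapP[w /wsG znw ->]; apply: znil_brauer_map.
rewrite size_map -(@ltn_pmul2l e); last by case: (e) lt_k => //; rewrite ltn0.
apply: leq_ltn_trans le_xs (leq_ltn_trans _ lt_k).
by rewrite leq_mul2r le_sk orbT.
Qed.

(** A class in the support whose defect group has order exactly p^k has a defect group S inside D,
    and the Brauer map at S already kills the product. *)
Lemma level_step k a (ws : seq (galg F gT)) : level k.+1 a ->
    {in ws, forall w, znil w} -> (k * (p ^ e - 1) < e * size ws)%N ->
  level k (a * \prod_(w <- ws) w).
Proof.
move=> lev_a wsG lt_k; set b := a * _.
have [clb suppb] : level k.+1 b.
  by apply: levelM => //; apply: clfun_prod => w /wsG[].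
split=> // x nzx; have [lt_x [P [g [Gg sylP sPD]]]] := suppb x nzx.
split; last by exists P, g.
move: lt_x; rewrite p_part !ltn_exp2l ?prime_gt1 // ltnS leq_eqVlt.
case/predU1P=> // log_x; have Gx : x \in G.
  by apply: contraNT nzx => nGx; case: clb => Gb _; rewrite Gb.
case/eqP: nzx.
have oS : #|(P :^ g)%G| = (p ^ k)%N.
  by rewrite cardJg (card_Hall sylP) p_part log_x.
have [xs _ b0] := brauer_map_mul0 lev_a sPD oS.
have sub0 : {subset [::] <= xs} by [].
have {b0} := b0 [::] ws sub0 wsG lt_k.
rewrite /gaug_prod big_nil mul1r => b0.
have [_ b_cl] := clb; have /subsetIP[_ cPx] := pHall_sub sylP.
have Cx : (x ^ g)%g \in 'C_G(P :^ g).
  rewrite inE groupJ //= -sub_cent1 cent1J conjSg.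
  exact: cPx.
have := congr1 (fun f : galg F gT => f (x ^ g)%g) b0.
by rewrite ffunE Cx galg0 b_cl.
Qed.

Lemma level_prod_eq0 k a (ws : seq (galg F gT)) : (0 < e)%N -> level k a ->
    {in ws, forall w, znil w} ->
    (\sum_(i < k) (i * (p ^ e - 1) %/ e).+1 <= size ws)%N ->
  a * \prod_(w <- ws) w = 0.
Proof.
move=> e_gt0; elim: k a ws => [|k IHk] a ws lev_a wsG.
  (* Level 0 is zero, since a p-part is never less than 1. *)
  move=> _; suff -> : a = 0 by rewrite mul0r.
  apply/ffunP=> x; rewrite galg0; apply/eqP/negPn/negP=> /(proj2 lev_a)[].
  by rewrite expn0 ltnS leqNgt part_gt0.
(* This m is the least number of factors with k(p^e - 1) < em, as [level_step] requires. *)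
rewrite big_ord_recr /=; set m := (k * (p ^ e - 1) %/ e).+1 => le_ws.
have le_m : (m <= size ws)%N by apply: leq_trans le_ws; apply: leq_addl.
rewrite -(cat_take_drop m ws) big_cat /= mulrA; apply: IHk.
- apply: level_step lev_a _ _ => [w /mem_take/wsG|]; first by [].
  by rewrite size_takel // [(e * m)%N]mulnC -ltn_divLR.
- by move=> w /mem_drop/wsG.
by rewrite size_drop leq_subRL // addnC.
Qed.

(** Instead of descending to level 1, [reynolds] is applied in G itself: the D-invariance of the
    Brauer image makes b depend only on p'-parts, so the p-th factor kills it. *)
Lemma prime_level_prod_eq0 a w (ws : seq (galg F gT)) : d = 1%N -> e = 1%N ->
    level 2 a -> {in ws, forall w, znil w} -> znil w -> size ws = p.-1 ->
  a * \prod_(w <- ws) w * w = 0.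
Proof.
move=> d1 e1 lev_a wsG [clw [n wn0]] sz_ws; set b := a * _.
have [clb suppb] : level 2 b.
  by apply: levelM => //; apply: clfun_prod => w' /wsG[].
have p_gt0 := prime_gt0 pr_p.
have oDp : #|D| = (p ^ 1)%N by rewrite oD d1.
have [xs defZ b0] := brauer_map_mul0 lev_a (subxx D) oDp.
have cDD : abelian D by rewrite cyclic_abelian // prime_cyclic // oDp expn1.
rewrite (center_idP cDD) in defZ.
have bD : {in D, forall z y,
    brauer_map 'C_G(D) b (z * y)%g = brauer_map 'C_G(D) b y}.
  apply: mul_gaug_invariant defZ _ => x; rewrite inE => Xx.
  have sX : {subset [:: x] <= xs} by move=> y; rewrite inE => /eqP->.
  have := b0 [:: x] ws sX wsG; rewrite /gaug_prod big_seq1; apply.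
  by rewrite e1 sz_ws mul1n expn1 mul1n /= subn1 add1n prednK.
clearbody b; apply: (reynolds chF clb _ clw wn0) => x Gx; have [Gb b_cl] := clb.
have [xp1 | ntxp] := eqVneq x.`_p 1%g.
  by rewrite -{1}(consttC p x) xp1 mul1g.
(* Used with y equal to x or to its p'-part. The nontrivial p-part of x is then conjugate to a
   generator of D, so x and its p'-part are carried into C_G(D), where they differ by an element of
   D. *)
suff eq_b y : y \in G -> x.`_p \in 'C[y] -> b y != 0 -> b x = b x.`_p^'.
  have [bx0 | nz_bx] := eqVneq (b x) 0; last first.
    by apply: (eq_b x) => //; apply/cent1P/commute_sym/commuteX.
  have [-> // | nz_bx'] := eqVneq (b x.`_p^') 0.
  apply: (eq_b x.`_p^') => //; first exact: groupX.
  by apply/cent1P/commute_sym/commuteX2.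
move=> Gy cyxp nz_by; have [_ [P [g [Gg sylP sPD]]]] := suppb y nz_by.
have pxp : p.-group <[x.`_p]> by apply: p_elt_constt.
have sxpy : <[x.`_p]> \subset 'C_G[y] by rewrite cycle_subG inE groupX.
have [h /setIP[Gh _] sxpP] := Sylow_Jsub sylP sxpy pxp.
pose c := (h * g)%g; have Gc : c \in G by rewrite groupM.
have Du : (x.`_p ^ c)%g \in D.
  apply: (subsetP sPD); rewrite conjgM memJ_conjg; apply: (subsetP sxpP).
  by rewrite memJ_conjg cycle_id.
have defD : <[x.`_p ^ c]>%g = D.
  apply/eqP; rewrite eqEsubset cycle_subG Du /=.
  apply: prime_meetG; first by rewrite oDp expn1.
  have /setIidPr-> : <[x.`_p ^ c]>%g \subset D by rewrite cycle_subG.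
  by rewrite cycle_eq1 conjg_eq1.
have cxp z : z \in G -> commute x.`_p z -> (z ^ c)%g \in 'C_G(D).
  move=> Gz cz; rewrite inE groupJ //= -defD cent_cycle.
  by apply/cent1P; rewrite /commute -!conjMg cz.
have Cx' : (x.`_p^' ^ c)%g \in 'C_G(D).
  by apply: cxp; [apply: groupX | apply: commuteX2].
have Cx : (x ^ c)%g \in 'C_G(D).
  by apply: cxp => //; apply/commute_sym/commuteX.
have := bD _ Du (x.`_p^' ^ c)%g; rewrite -conjMg consttC !ffunE Cx Cx'.
by rewrite !b_cl.
Qed.

End Levels.

(** * Blocks and the centre of the group ring *)

Section Coefficients.

Variables (F : fieldType) (gT : finGroupType) (G : {group gT}).
Local Notation aG := (regular_repr F G).
Local Notation R_G := (group_ring F G).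
Implicit Types (A B : 'M[F]_#|G|).

(** The row indexed by 1 in the regular representation lists the coefficients of a group ring
    element. *)
Definition gcoef A : galg F gT :=
  [ffun x => if x \in G then A (gring_index G 1%g) (gring_index G x) else 0].

Lemma gcoef0 : gcoef 0 = 0.
Proof. by apply/ffunP=> x; rewrite !ffunE mxE if_same. Qed.

Lemma gcoefD : {morph gcoef : A B / A + B}.
Proof.
by move=> A B; apply/ffunP=> x; rewrite !ffunE mxE; case: ifP; rewrite ?addr0.
Qed.

Lemma supported_gcoef A : supported G (gcoef A).
Proof. by move=> x /negPf nGx; rewrite ffunE nGx. Qed.

Lemma regular_mxE g x y : g \in G -> x \in G -> y \in G ->
  aG g (gring_index G x) (gring_index G y) = ((x * g)%g == y)%:R.
Proof.
move=> Gg Gx Gy; rewrite /= /regular_mx !mxE eqxx /= gring_indexK //.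
by rewrite (can_in_eq (@gring_indexK _ G)) ?groupM // eq_sym.
Qed.

Lemma group_ring_mxE A x y : (A \in R_G)%MS -> x \in G -> y \in G ->
  A (gring_index G x) (gring_index G y) = gcoef A (x^-1 * y)%g.
Proof.
case/envelop_mxP=> c -> Gx Gy; rewrite ffunE groupM ?groupV // !summxE.
apply: eq_bigr => g Gg; rewrite [LHS]mxE [RHS]mxE.
rewrite !regular_mxE ?groupM ?groupV //.
by rewrite mul1g -(inj_eq (mulgI x^-1%g)) mulKg.
Qed.

Lemma gcoef_eq0 A : (A \in R_G)%MS -> gcoef A = 0 -> A = 0.
Proof.
move=> RA A0; apply/matrixP=> i j; rewrite -(gring_valK i) -(gring_valK j).
by rewrite group_ring_mxE ?enum_valP // A0 galg0 mxE.
Qed.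

Lemma gcoefM A B : (A \in R_G)%MS -> (B \in R_G)%MS ->
  gcoef (A *m B) = gcoef A * gcoef B.
Proof.
move=> RA RB; apply/ffunP=> x; rewrite [LHS]ffunE.
case: ifPn => [Gx | nGx]; last first.
  by rewrite (supportedM (@supported_gcoef A) (@supported_gcoef B)).
rewrite mxE galgM (bigID (mem G)) /=.
rewrite [X in _ + X]big1 ?addr0 => [|y nGy]; last first.
  by rewrite supported_gcoef ?mul0r.
rewrite (reindex_onto (gring_index G) enum_val) => /= [|i _]; last first.
  exact: gring_valK.
apply: eq_big => [y | y /eqP Gy].
  apply/eqP/idP => [<- | Gy]; first exact: enum_valP.
  exact: gring_indexK.
have {}Gy : y \in G by rewrite -Gy enum_valP.
by rewrite group_ring_mxE // group_ring_mxE // invg1 mul1g.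
Qed.

Lemma gcoef_repr g : g \in G -> gcoef (aG g) = gelem F g.
Proof.
move=> Gg; apply/ffunP=> x; rewrite !ffunE; case: ifPn => [Gx | nGx].
  by rewrite regular_mxE // mul1g eq_sym.
by case: eqP nGx => // ->; rewrite Gg.
Qed.

Lemma mem_repr_group_ring g : g \in G -> (aG g \in R_G)%MS.
Proof. exact: envelop_mx_id. Qed.

Lemma gcoefJ A g x : (A \in R_G)%MS -> g \in G ->
  gcoef (aG g^-1%g *m A *m aG g) x = gcoef A (x ^ g^-1)%g.
Proof.
move=> RA Gg; have RG := mem_repr_group_ring.
have [Rg Rg'] := (RG _ Gg, RG _ (groupVr Gg)).
rewrite -mulmxA !gcoefM ?gcoef_repr ?groupV ?envelop_mxM //.
by rewrite gelem_mull gelem_mulr conjgE invgK mulgA.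
Qed.

Lemma clfun_gcoef A : (A \in R_G)%MS ->
  {in G, forall g, A *m aG g = aG g *m A} -> clfun G (gcoef A).
Proof.
move=> RA cA; split=> [|x g Gg]; first exact: supported_gcoef.
have Gg' := groupVr Gg; rewrite -[g]invgK -gcoefJ // invgK -mulmxA cA //.
by rewrite mulmxA -repr_mxM // mulgV repr_mx1 mul1mx.
Qed.

Lemma gcoef_rel_trace (D : {group gT}) A x : D \subset G -> fixed_by D A ->
  gcoef (rel_trace D A) x
    = \sum_(X in rcosets D G) gcoef A (x ^ (repr X)^-1)%g.
Proof.
move=> sDG [RA _]; rewrite (big_morph _ gcoefD gcoef0) sum_ffunE.
apply: eq_bigr => X /rcosetsP[c Gc ->]; apply: gcoefJ => //.
have /rcosetP[q Dq ->] := mem_repr_rcoset D c.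
by rewrite groupM // (subsetP sDG).
Qed.

(** P centralizes x, so the terms of the trace are constant on P-orbits of cosets. A nonzero sum
    needs a fixed coset Dc, that is, P inside D^c. *)
Lemma rel_trace_neq0 p (D P : {group gT}) A x : p \in [pchar F] ->
    D \subset G -> fixed_by D A -> p.-Sylow('C_G[x]) P ->
  gcoef (rel_trace D A) x != 0 -> exists2 g, g \in G & P :^ g \subset D.
Proof.
move=> chF sDG fixA sylP nz_x; have [RA DA] := fixA.
have /subsetIP[sPG cPx] := pHall_sub sylP; have pP := pHall_pgroup sylP.
pose phi c := gcoef A (x ^ c^-1)%g.
have phiD q c : q \in D -> phi (q * c)%g = phi c.
  move=> Dq; rewrite /phi invMg conjgM -gcoefJ ?(subsetP sDG) //.
  by rewrite DA.
have phi_repr c : phi (repr (D :* c)%g) = phi c.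
  by have /rcosetP[q Dq ->] := mem_repr_rcoset D c; apply: phiD.
have actP : [acts P, on rcosets D G | 'Rs].
  exact: subset_trans sPG (actsRs_rcosets _ _).
move: nz_x; rewrite gcoef_rel_trace // (sum_pgroup_fix chF pP actP); last first.
  move=> u _ Pu /rcosetsP[c Gc ->] /=; rewrite rcosetE -rcosetM.
  rewrite -/(phi _) -/(phi (repr (D :* c))) !phi_repr /phi invMg conjgM.
  congr (gcoef A (_ ^ _)%g); apply/conjg_fixP/commgP/commute_sym.
  by apply/cent1P; rewrite groupV (subsetP cPx).
have [-> | [X]] := set_0Vmem 'Fix_(rcosets D G | 'Rs)(P).
  by rewrite big_set0 eqxx.
case/setIP=> /rcosetsP[c Gc ->]; rewrite sub_afixRs_norms => sPDc _.
by exists c^-1%g; rewrite ?groupV // sub_conjgV.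
Qed.

End Coefficients.

(** * Powers of the Jacobson radical and Loewy length *)

Section JacobsonPowers.

Variables (F : fieldType) (n : nat) (A : 'A[F]_n).
Implicit Types (x y b : 'M[F]_n).

Lemma jacobson_pow_ind (R : 'M[F]_n -> Prop) k :
    R 0 -> (forall y z, R y -> R z -> R (y + z)) ->
    (forall ws b, size ws = k -> {in ws, forall x, (x \in jacobson A)%MS} ->
      (b \in A)%MS -> R (foldr mulmx b ws)) ->
  forall y, (y \in jacobson_pow A k)%MS -> R y.
Proof.
elim: k R => [|k IHk] R R0 RD Rprod y /=; first exact: (Rprod [::]).
case/mulsmxP=> x Jx [z Iz ->]; apply: (big_ind R) => // i _.
apply: (IHk (fun z => R (x i *m z))) (Iz i) => [|z1 z2|ws b sz_ws Jws Ab].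
- by rewrite mulmx0.
- by rewrite mulmxDr; apply: RD.
apply: (Rprod (x i :: ws)) => //=; first by rewrite sz_ws.
by move=> x' /[1!inE] /predU1P[-> | /Jws].
Qed.

Lemma loewy_length_le k : mxring A ->
    (forall ws b, size ws = k -> {in ws, forall x, (x \in jacobson A)%MS} ->
      (b \in A)%MS -> foldr mulmx b ws = 0) ->
  (loewy_length A <= k)%N.
Proof.
move=> ringA prod0; apply: (proj2 (loewy_lengthP ringA)).
apply/eqP; rewrite -submx0; apply/memmx_subP=> y Jy.
suff -> : y = 0 by apply: mem0mx.
by apply: (jacobson_pow_ind (R := eq^~ 0)) Jy => // y1 z1 -> ->; apply: addr0.
Qed.

Lemma jacobson_nilpotent : mxring A ->
  exists k, forall x b, (x \in jacobson A)%MS -> (b \in A)%MS ->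
    iter k (mulmx x) b = 0.
Proof.
move=> ringA; have [Jl0 _] := loewy_lengthP ringA.
exists (loewy_length A) => x b Jx Ab; apply: memmx0; rewrite -{}Jl0.
elim: (loewy_length A) => [|k IHk] //=.
by apply: mem_mulsmx.
Qed.

End JacobsonPowers.

(** * From the centre of a block to the filtration of Z(FG) *)

Section Blocks.

Variables (F : fieldType) (gT : finGroupType) (G D : {group gT}) (p : nat).
Variables (B : 'A[F]_#|G|) (d e : nat).
Hypotheses (chF : p \in [pchar F]) (blockB : is_block B) (sDG : D \subset G).
Hypotheses (trB : id_in_trace B D) (oD : #|D| = (p ^ d)%N).
Hypothesis expD : exponent D = (p ^ e)%N.
Local Notation R_G := (group_ring F G).

Let ringZB : mxring 'Z(B)%MS := mxring_center (mxring_block blockB).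
Let sBR : (B <= R_G)%MS. Proof. by case: blockB => [[]]. Qed.

Lemma center_block_commute x y : (x \in 'Z(B))%MS -> (y \in R_G)%MS ->
  x *m y = y *m x.
Proof.
move=> /center_mxP[Bx cx] Ry.
have [[_ /andP[sRB sRB']] _ _ _] := blockB.
have [a _ [_ Bb idl idr]] := trB; move: (rel_trace D a) => b in Bb idl idr.
rewrite -{1}(idr x Bx) -mulmxA -cx; last by rewrite (mulsmx_subP sRB').
by rewrite -mulmxA idl // (mulsmx_subP sRB).
Qed.

Lemma gcoef_center_block x : (x \in 'Z(B))%MS -> clfun G (gcoef x).
Proof.
move=> Zx; have /center_mxP[Bx _] := Zx.
apply: clfun_gcoef => [|g Gg]; first exact: submx_trans Bx sBR.
by apply: center_block_commute; rewrite ?mem_repr_group_ring.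
Qed.

(** The block idempotent is a relative trace from D, hence in this level, and x is a multiple of
    it. *)
Lemma level_center_block x : (x \in 'Z(B))%MS -> level p G D d.+1 (gcoef x).
Proof.
move=> Zx; have [a fixa [_ Be idl idr]] := trB.
set b := rel_trace D a in Be idl idr.
have Zb : (b \in 'Z(B))%MS.
  by apply/center_mxP; split=> // y By; rewrite idl ?idr.
have /center_mxP[Bx _] := Zx.
rewrite -(idl x Bx) gcoefM; try exact: submx_trans sBR.
apply: (@levelM _ _ _ G D chF _ _ _ _ (gcoef_center_block Zx)).
split=> [|y nzy]; first exact: gcoef_center_block.
have [P sylP] := Sylow_exists p 'C_G[y].
have [g Gg sPD] := rel_trace_neq0 chF sDG fixa sylP nzy.
split; last by exists P, g.
rewrite -(card_Hall sylP) -(cardJg P g).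
apply: leq_ltn_trans (subset_leq_card sPD) _.
by rewrite oD ltn_exp2l // (prime_gt1 (pcharf_prime chF)).
Qed.

Lemma znil_jacobson x : (x \in jacobson 'Z(B))%MS -> znil G (gcoef x).
Proof.
move=> Jx; have [Zx _] := (is_jacobson_jacobson 'Z(B)%MS x).1 Jx.
split; first exact: gcoef_center_block.
have [k /(_ x x Jx Zx) xk0] := jacobson_nilpotent ringZB.
have /center_mxP[Bx _] := Zx; have Rx := submx_trans Bx sBR.
exists k.+1; rewrite -(gcoef0 F G) -{}xk0.
suff [-> _] : gcoef (iter k (mulmx x) x) = gcoef x ^+ k.+1
  /\ (iter k (mulmx x) x \in R_G)%MS by [].
elim: k => [|k [IHk RIk]] /=; first by rewrite expr1.
by rewrite gcoefM // IHk -exprS; split=> //; apply: envelop_mxM.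
Qed.

Lemma gcoef_foldr (ws : seq 'M[F]_#|G|) b :
    {in ws, forall x, (x \in jacobson 'Z(B))%MS} -> (b \in 'Z(B))%MS ->
  (foldr mulmx b ws \in R_G)%MS /\
  gcoef (foldr mulmx b ws) = gcoef b * \prod_(w <- map (@gcoef _ _ G) ws) w.
Proof.
move=> Jws Zb; have /center_mxP[Bb _] := Zb.
elim: ws Jws => [|x ws IHws] Jws /=.
  by rewrite big_nil mulr1; split=> //; apply: submx_trans sBR.
have Jx := Jws x (mem_head x ws); have [clx _] := znil_jacobson Jx.
have [Zx _] := (is_jacobson_jacobson 'Z(B)%MS x).1 Jx.
have /center_mxP[Bx _] := Zx; have Rx := submx_trans Bx sBR.
have [|Rf defF] := IHws.
  by move=> y ws_y; apply: Jws; rewrite inE ws_y orbT.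
split; first exact: envelop_mxM.
rewrite gcoefM // defF big_cons mulrA mulrA; congr (_ * _).
by apply: (clfun_comm clx); apply: supported_gcoef.
Qed.

Lemma loewy_center_block_le k :
    (forall a (ws : seq (galg F gT)), level p G D d.+1 a -> size ws = k ->
      {in ws, forall w, znil G w} -> a * \prod_(w <- ws) w = 0) ->
  (loewy_length 'Z(B)%MS <= k)%N.
Proof.
move=> prod0; apply: loewy_length_le ringZB _ => ws b sz_ws Jws Zb.
have [Rf defF] := gcoef_foldr Jws Zb.
apply: gcoef_eq0 Rf _; rewrite defF; apply: prod0.
- exact: level_center_block.
- by rewrite size_map.
by move=> _ /mapP[x ws_x ->]; apply/znil_jacobson/Jws.
Qed.

Lemma loewy_center_block : (0 < e)%N ->
  (loewy_length 'Z(B)%MS <= \sum_(i < d.+1) (i * (p ^ e - 1) %/ e).+1)%N.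
Proof.
move=> e_gt0; apply: loewy_center_block_le => a ws lev_a sz_ws wsG.
exact: (level_prod_eq0 chF sDG oD expD e_gt0 lev_a wsG (eq_leq (esym sz_ws))).
Qed.

Lemma loewy_center_block_prime : d = 1%N -> e = 1%N ->
  (loewy_length 'Z(B)%MS <= p)%N.
Proof.
move=> d1 e1; apply: loewy_center_block_le => a ws; rewrite d1 => lev_a.
have p_gt0 := prime_gt0 (pcharf_prime chF).
case/lastP: ws => [/esym p0|ws w]; first by rewrite p0 in p_gt0.
rewrite size_rcons => sz_ws wsG; rewrite -cats1 big_cat big_seq1 /= mulrA.
apply: (prime_level_prod_eq0 chF sDG oD expD d1 e1 lev_a).
- by move=> w' ws_w'; apply: wsG; rewrite mem_rcons inE ws_w' orbT.
- by apply: wsG; rewrite mem_rcons mem_head.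
by rewrite -sz_ws.
Qed.

End Blocks.

(** * Arithmetic of the bound *)

Section Bounds.

Local Open Scope nat_scope.

Lemma sum_level_bound d e Q : 0 < e ->
  2 * e * (\sum_(i < d.+1) (i * Q %/ e).+1) <= 2 * e * d.+1 + d * d.+1 * Q.
Proof.
move=> e_gt0; elim: d => [|d IHd].
  by rewrite big_ord_recl big_ord0 mul0n div0n addn0 addn0.
rewrite big_ord_recr /=; move: (\sum_(i < _) _) IHd => S IHd.
have := leq_divM (d.+1 * Q) e; move: (d.+1 * Q %/ e) => m le_m.
by nia.
Qed.

(** With P = p - 1 and Q = p^e - 1 this is the rational bound multiplied by 2eP. As eP <= Q, the
    left side is at most (d + 1)(dP + 2)Q, and e >= 1. *)
Lemma loewy_bound_nat d e P Q N : 0 < e -> e * P <= Q ->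
    2 * e * N <= 2 * e * d.+1 + d * d.+1 * Q ->
  2 * e * P * N <= (d + e) * (d * P + 2) * Q.
Proof.
move=> e_gt0 le_eP le_N.
have h1 : 2 * e * P * N <= P * (2 * e * d.+1 + d * d.+1 * Q).
  have -> : 2 * e * P * N = P * (2 * e * N) by ring.
  by rewrite leq_mul2l le_N orbT.
apply: leq_trans h1 _.
have h2 : 2 * d.+1 * (e * P) <= 2 * d.+1 * Q by rewrite leq_mul2l le_eP orbT.
have h3 : d * P * Q * 1 <= d * P * Q * e by rewrite leq_mul2l e_gt0 orbT.
have h4 : 2 * Q * 1 <= 2 * Q * e by rewrite leq_mul2l e_gt0 orbT.
by nia.
Qed.

End Bounds.

Import Order.TTheory Num.Theory.

Theorem theorem6 (gT : finGroupType) (G : {group gT})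
    (F : closedFieldType) (p : nat) (hp : p \in [pchar F])
    (B : 'A[F]_#|G|) (hB : is_block B)
    (D : {group gT}) (hD : is_defect_group B D)
    (d e : nat) (hd : #|D| = (p ^ d)%N) (hD1 : (1 < p ^ d)%N)
    (he : exponent D = (p ^ e)%N) :
  (loewy_length 'Z(B)%MS)%:R <=
      (d%:R / e%:R + 1) * (d%:R / 2%:R + 1 / (p%:R - 1)) * ((p ^ e)%:R - 1)
      :> rat
  /\ (loewy_length 'Z(B)%MS <= d ^ 2 * p ^ e)%N.
Proof.
have [sDG trB _] := hD; have pr_p := pcharf_prime hp.
have p_gt1 := prime_gt1 pr_p.
have e_gt0 : (0 < e)%N.
  rewrite lt0n; apply: contraTneq hD1 => e0; rewrite -hd -leqNgt.
  by rewrite -trivg_card_le1 trivg_exponent he e0.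
have := loewy_center_block hp hB sDG trB hd he e_gt0.
set L := loewy_length _ => le_L.
have le_eQ : (e * (p - 1) <= p ^ e - 1)%N.
  by have := leq_expn_pred (ltnW p_gt1) e_gt0; rewrite expn1 mul1n.
have le_LQ : (2 * e * L <= 2 * e * d.+1 + d * d.+1 * (p ^ e - 1))%N.
  apply: leq_trans (sum_level_bound d (p ^ e - 1) e_gt0).
  by rewrite leq_mul2l le_L orbT.
have q_gt0 : (0 < p ^ e)%N by rewrite expn_gt0 ltnW.
split.
  have := loewy_bound_nat e_gt0 le_eQ le_LQ.
  rewrite -(ler_nat rat) !(natrM, natrD) !natrB ?(ltnW p_gt1) // => le_rat.
  have e_pos : 0 < e%:R :> rat by rewrite ltr0n.
  have P_pos : 0 < p%:R - 1 :> rat by rewrite subr_gt0 ltr1n.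
  have -> : (d%:R / e%:R + 1) * (d%:R / 2%:R + 1 / (p%:R - 1))
      * ((p ^ e)%:R - 1) = ((d%:R + e%:R) * (d%:R * (p%:R - 1) + 2%:R)
      * ((p ^ e)%:R - 1)) / (2%:R * e%:R * (p%:R - 1)) :> rat.
    by field; rewrite !gt_eqF.
  rewrite ler_pdivlMr ?mulr_gt0 // mulrC; exact: le_rat.
have d_gt0 : (0 < d)%N by rewrite lt0n; apply: contraTneq hD1 => ->.
(* For d = 1 the general sum is p + 1, one more than the desired p. For d >= 2 the inequality d + 1
   <= d^2 suffices. *)
have [d1 | d_neq1] := eqVneq d 1%N.
  have e1 : e = 1%N.
    apply/eqP; rewrite eqn_leq e_gt0 andbT -(leq_exp2l _ _ p_gt1) -he.
    by rewrite -[1%N]d1 -hd dvdn_leq ?exponent_dvdn.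
  have := loewy_center_block_prime hp hB sDG trB hd he d1 e1.
  by rewrite d1 e1 exp1n mul1n expn1.
have d_gt1 : (1 < d)%N by rewrite ltn_neqAle eq_sym d_neq1.
rewrite -(@leq_pmul2l (2 * e)) ?muln_gt0 //; apply: leq_trans le_LQ _.
rewrite -{2}(subnK q_gt0); move: (p ^ e - 1)%N => Q.
have h1 : (d.+1 <= d * d)%N by nia.
have h2 : (d * d.+1 <= 2 * (d * d))%N by nia.
rewrite mulnDr muln1 mulnDr addnC leq_add //.
  rewrite !mulnA -(mulnA 2%N) mulnAC.
  by nia.
by rewrite leq_mul2l h1 orbT.
Qed.
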